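(* Let $a>0$, $b>0$, and consider the symmetric exclusion process on $\Omega^*=\{0,1\}^{\mathbb{Z}^d\setminus\{0\}}$ with birth and death of particles at the neighbours of the origin, with generator $\mathcal{L}_{ab}$ (see context). When $d\ge5$, there is a stationary measure $\mu^{ab}_\rho$, for any $\rho\in\,]0,1[$, such that $$\bigotimes_{i\ne0}\nu_{\alpha_i}\prec\mu^{ab}_\rho\prec\bigotimes_{i\ne0}\nu_{\tilde\alpha_i}\quad\text{and}\quad 1+C_{ab}\,\mathbb{P}_i(H_0<\infty)=\frac{\tilde\alpha_i}{\rho}\,\frac{1-\rho}{1-\tilde\alpha_i}=\frac{\rho}{\alpha_i}\,\frac{1-\alpha_i}{1-\rho}\qquad(i\in\mathbb{Z}^d\setminus\{0\}),$$ where $C_{ab}$ is a positive constant depending on $a$ and $b$.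
   Context: Generator, acting on local functions $\varphi$ on $\Omega^*$: $$\mathcal{L}_{ab}\varphi(\eta)=\sum_{e}\bigl(\varphi(T^e\eta)-\varphi(\eta)\bigr)+\sum_{k\sim0}\bigl(a\,\eta(k)+b(1-\eta(k))\bigr)\bigl(\varphi(\sigma_k\eta)-\varphi(\eta)\bigr),$$ where the first sum runs over nearest-neighbour bonds $e=(i,j)$ of $\mathbb{Z}^d$ not containing the origin, $T^{e}\eta$ is $\eta$ with the contents of $i$ and $j$ exchanged, $k\sim0$ means that $k$ is a nearest neighbour of the origin, and $\sigma_k\eta$ is $\eta$ with the value at $k$ flipped ($\sigma_k\eta(k)=1-\eta(k)$, other coordinates unchanged). Thus particles at neighbours of the origin die at rate $a$ and are born at rate $b$. $\mathbb{P}_i(H_0<\infty)$ is the probability that a symmetric simple random walk on $\mathbb{Z}^d$ starting at site $i$ hits the origin. $\bigotimes_{i\ne0}\nu_{\alpha_i}$ is the product Bernoulli measure on $\Omega^*$ with density $\alpha_i$ at site $i$ of $\mathbb{Z}^d\setminus\{0\}$ (similarly with $\tilde\alpha_i$). Order on $\Omega^*$: coordinatewise. For probability measures, $\mu\prec\nu$ means $\int f\,d\mu\le\int f\,d\nu$ for all increasing functions $f$.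
   Formalization: The constant C may depend on ρ (and d) as well as on a and b: one C for all ρ is impossible, since stationarity forces density at least b/(a+b+2d-1) at neighbours of the origin, while for fixed C the upper density there tends to 0 as ρ→0. *)

(* Defs.v *)
From HB Require Import structures.
From mathcomp Require Import all_boot all_order all_algebra.
From mathcomp Require Import all_classical all_reals all_analysis.

Set Implicit Arguments.
Unset Strict Implicit.
Unset Printing Implicit Defensive.

Import Order.TTheory GRing.Theory Num.Theory.
Import numFieldTopology.Exports numFieldNormedType.Exports.

Local Open Scope classical_set_scope.
Local Open Scope ring_scope.

(* Z^d is 'rV[int]_d. *)

Definition unit_step d : set 'rV[int]_d :=
  [set v | exists k : 'I_d, v = delta_mx 0 k \/ v = - delta_mx 0 k].

(* Z^d \ {0} *)
Definition site d := {x : 'rV[int]_d | x != 0}.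

(* {0,1}^(Z^d \ {0}) with the product topology, bool being discrete. *)
Definition config d : Type := prod_topology (fun _ : site d => bool).

HB.instance Definition _ d := Pointed.on (config d).
HB.instance Definition _ d := Nbhs.on (config d).
HB.instance Definition _ d := Topological.on (config d).

(* The product sigma-algebra, generated by the coordinate maps. As there are
   countably many sites, it is also the Borel sigma-algebra. *)
Definition coordinate_sets d : set (set (config d)) :=
  [set A : set (config d) | exists x, A = [set eta : config d | eta x]].

HB.instance Definition _ d :=
  Measurable.copy (config d) (g_sigma_algebraType (@coordinate_sets d)).

Section configurations.
Context {d : nat}.
Implicit Types (eta zeta : config d) (i j k : site d).

Definition exchange i j eta : config d :=
  fun k => if k == i then eta j else if k == j then eta i else eta k.

Definition flip k eta : config d :=
  fun j => if j == k then ~~ eta j else eta j.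

Definition config_le eta zeta := forall k, eta k ==> zeta k.

End configurations.

(* Bonds avoiding the origin. Orienting each bond in the direction of
   increasing coordinate makes every unordered bond appear exactly once. *)
Definition bonds d : set (site d * site d) :=
  [set e | exists k : 'I_d, val e.2 = val e.1 + delta_mx 0 k].

Definition origin_nbrs d : set (site d) := [set k | unit_step (val k)].

Definition is_local (T : Type) d (phi : config d -> T) :=
  exists2 A : set (site d), finite_set A &
    forall eta zeta, {in A, eta =1 zeta} -> phi eta = phi zeta.

(* The sums over sets are finitely supported sums: for local phi only finitely
   many bonds contribute. *)
Definition gen (R : realType) d (a b : R) (phi : config d -> R)
    (eta : config d) : R :=
  \sum_(e \in @bonds d) (phi (exchange e.1 e.2 eta) - phi eta) +
  \sum_(k \in @origin_nbrs d)
    (a * (eta k)%:R + b * (1 - (eta k)%:R)) * (phi (flip k eta) - phi eta).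

(* Markov (Feller) semigroups on C(config d); the values of S t on
   discontinuous functions and for t < 0 are irrelevant. *)
Record markov_semigroup (R : realType) d
    (S : R -> (config d -> R) -> config d -> R) : Prop := MarkovSemigroup {
  semigroup_continuous : forall (t : R) (f : config d -> R), 0 <= t ->
    continuous f -> continuous (S t f);
  semigroup_linear : forall (t c : R) (f g : config d -> R), 0 <= t ->
    continuous f -> continuous g ->
    S t (fun eta => c * f eta + g eta) = fun eta => c * S t f eta + S t g eta;
  semigroup_pos : forall (t : R) (f : config d -> R), 0 <= t -> continuous f ->
    (forall eta : config d, 0 <= f eta) -> forall eta, 0 <= S t f eta;
  semigroup_one : forall t : R, 0 <= t -> S t (fun=> 1) = fun=> 1;
  semigroup_zero : forall f : config d -> R, continuous f -> S 0 f = f;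
  semigroup_add : forall (s t : R) (f : config d -> R), 0 <= s -> 0 <= t ->
    continuous f -> S (s + t) f = S s (S t f);
  semigroup_strong_continuity : forall f : config d -> R, continuous f ->
    {uniform, (fun t => S t f) @ 0^'+ --> f} }.

(* Local functions are in the domain of the infinitesimal generator of S, which
   is given there by L. *)
Definition generated_by (R : realType) d
    (S : R -> (config d -> R) -> config d -> R)
    (L : (config d -> R) -> config d -> R) :=
  forall phi : config d -> R, is_local phi ->
    {uniform, (fun t eta => (S t phi eta - phi eta) / t) @ 0^'+ --> L phi}.

Definition stationary (R : realType) d
    (S : R -> (config d -> R) -> config d -> R)
    (mu : probability (config d) R) :=
  forall (t : R) (f : config d -> R), 0 <= t -> continuous f ->
    (\int[mu]_eta (S t f eta)%:E = \int[mu]_eta (f eta)%:E)%E.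

(* Increasing functions need not be bounded, so the comparison is between
   integrals that exist. *)
Definition dominated (R : realType) d (mu nu : probability (config d) R) :=
  forall f : config d -> R,
    {homo f : eta zeta / config_le eta zeta >-> eta <= zeta} ->
    mu.-integrable setT (EFin \o f) -> nu.-integrable setT (EFin \o f) ->
    (\int[mu]_eta (f eta)%:E <= \int[nu]_eta (f eta)%:E)%E.

Definition product_bernoulli (R : realType) d (alpha : site d -> R)
    (nu : probability (config d) R) :=
  (forall i, 0 <= alpha i <= 1) /\
  forall (s : seq (site d)) (zeta : config d), uniq s ->
    nu [set eta : config d | {in s, eta =1 zeta}] =
    (\prod_(i <- s) if zeta i then alpha i else 1 - alpha i)%:E.

(* xi is an i.i.d. sequence, uniform on the 2d unit steps. *)
Definition srw_steps (R : realType) d dW (W : measurableType dW)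
    (P : probability W R) (xi : nat -> W -> 'rV[int]_d) :=
  (forall n v, measurable [set w | xi n w = v]) /\
  forall n (v : nat -> 'rV[int]_d), (forall m, (m < n)%N -> unit_step (v m)) ->
    P [set w | forall m, (m < n)%N -> xi m w = v m] = ((2 * d)%:R^-1 ^+ n)%:E.

(* P_i(H_0 < oo) for the walk with steps xi started at i *)
Definition hitting_prob (R : realType) d dW (W : measurableType dW)
    (P : probability W R) (xi : nat -> W -> 'rV[int]_d) (i : 'rV[int]_d) : R :=
  fine (P [set w | exists n, i + \sum_(m < n) xi m w = 0]).

(* Main.v *)
(* Write lam = rho / (1 - rho) and m i = 1 + C * P_i(H_0 < oo), so that alpha' and
   alpha have odds lam * m and lam / m, and m is superharmonic off the origin. Let
   E and Cov refer to the product measure of density alpha'. For an increasing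
   local f and a bond e = (i, j),
     E[f o T^e - f] = (m j - m i) / m i * Cov(f, eta i)
       + (m i - m j) / m j * Cov(f, eta j)
       - (m i - m j)^2 / (m i * m j) * Cov(f, eta i * eta j),
   where all covariances are nonnegative. Summed over the bonds, the first two
   terms are nonpositive by superharmonicity. The birth and death terms are
   nonpositive as soon as lam * m >= b / a next to the origin, which holds for a
   large C since a neighbour of the origin hits it with probability at least
   1 / (2 d). So E[L f] <= 0; for alpha the inequality is reversed.

   To pass to the semigroup, S_t g is approximated uniformly by Euler steps of
   the dynamics restricted to a large box. A short step is a convex combination
   of compositions with increasing maps, so it preserves increasing functions,
   and a linearly weighted sum of the influences of the sites grows at most
   exponentially in time, which bounds the effect of the bonds cut by the box.
   Hence t |-> nu S_t is stochastically increasing and stays below nu'; its limit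
   is the stationary measure. The comparison for continuous functions extends to
   all increasing functions by inner regularity of increasing sets. *)
Require Import Defs.
From HB Require Import structures.
From mathcomp Require Import all_boot all_order all_algebra.
From mathcomp Require Import all_classical all_reals all_analysis.
From mathcomp Require Import measurable_realfun finmap zify ring lra.

Import Order.TTheory GRing.Theory Num.Theory.
Import numFieldTopology.Exports numFieldNormedType.Exports.

Local Open Scope classical_set_scope.
Local Open Scope ring_scope.

Set Implicit Arguments.
Unset Strict Implicit.
Unset Printing Implicit Defensive.

(** * Local functions *)

(** The obstacle is that [S] is known only through its action on local functions near time 0, while
    [S t g] is in general no longer local for t > 0. The sign of E[L f] for local increasing f
    therefore cannot be integrated along the semigroup directly; it is applied to the Euler
    iterates, which stay local and increasing and remain close to [S t g]. Truncating to a box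
    changes L f only through influences at the boundary of the box, and weighting a site by 1 plus
    its l1 norm turns a bound on the weighted sum of influences into an error of order 1 / n.

    Measures are handled as positive normalised functionals on local functions. nu S_n converges on
    increasing local functions by monotonicity, and these span all local functions. A Caratheodory
    extension then yields mu together with approximation from outside by local sets, which is the
    regularity used for increasing sets.

    The lower bound mirrors the upper one: exchanging particles and holes swaps a with b and lam
    with 1 / lam. Hence most estimates are stated so as to cover both E' and - E, and C has to meet
    one condition for each side. *)

Definition depends (T : Type) d (s : seq (site d)) (phi : config d -> T) :=
  forall eta zeta : config d, {in s, eta =1 zeta} -> phi eta = phi zeta.

Definition set_at d (x : site d) (v : bool) (eta : config d) : config d :=
  fun y => if y == x then v else eta y.

Definition all_occupied (R : realType) d (t : seq (site d)) (eta : config d) : R :=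
  (all eta t)%:R.

Definition increasing (R : realType) d (f : config d -> R) :=
  {homo f : eta zeta / config_le eta zeta >-> eta <= zeta}.

Section depends.
Context {d : nat}.
Implicit Types (s t : seq (site d)) (eta zeta : config d).

Lemma dependsW (T : Type) s t (phi : config d -> T) :
  {subset s <= t} -> depends s phi -> depends t phi.
Proof. by move=> st sphi eta zeta ez; apply: sphi => x /st; exact: ez. Qed.

Lemma is_localP (T : Type) (phi : config d -> T) :
  is_local phi <-> exists s, depends s phi.
Proof.
split=> [[A /finite_seqP[s ->] sphi]|[s sphi]].
  by exists s => eta zeta ez; apply: sphi => x /set_mem; exact: ez.
exists [set` s]; first exact: finite_seq.
by move=> eta zeta ez; apply: sphi => x xs; apply: ez; exact/mem_set.
Qed.

Lemma depends_local (T : Type) s (phi : config d -> T) :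
  depends s phi -> is_local phi.
Proof. by move=> sphi; apply/is_localP; exists s. Qed.

Lemma local_cst (T : Type) (c : T) : @is_local T d (fun=> c).
Proof. by apply: (@depends_local _ [::]). Qed.

Lemma local_comp2 (T U V : Type) (h : T -> U -> V) (phi : config d -> T)
    (psi : config d -> U) :
  is_local phi -> is_local psi -> is_local (fun eta => h (phi eta) (psi eta)).
Proof.
move=> /is_localP[s sphi] /is_localP[t tpsi]; apply/is_localP; exists (s ++ t).
move=> eta zeta ez; congr h; [apply: sphi|apply: tpsi] => x xs; apply: ez;
  by rewrite mem_cat xs ?orbT.
Qed.

Lemma local_comp (T U : Type) (h : T -> U) (phi : config d -> T) :
  is_local phi -> is_local (fun eta => h (phi eta)).
Proof.
by move=> lphi; exact: (@local_comp2 _ unit _ (fun x _ => h x) _ _ lphi (local_cst tt)).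
Qed.

Lemma depends_set_at (T : Type) x v s (phi : config d -> T) :
  depends (x :: s) phi -> depends s (fun eta => phi (set_at x v eta)).
Proof.
move=> xsphi eta zeta ez; apply: xsphi => y; rewrite inE /set_at.
by case: eqP => //= _; exact: ez.
Qed.

Lemma set_at_id x eta : set_at x (eta x) eta = eta.
Proof. by apply/funext => y; rewrite /set_at; case: eqP => [->|]. Qed.

End depends.

Section local_induction.
Context {R : realType} {d : nat}.
Implicit Types (s t : seq (site d)) (eta zeta : config d) (phi psi : config d -> R).

Lemma depends_all_occupied t : depends t (@all_occupied R d t).
Proof. by move=> eta zeta ez; rewrite /all_occupied (eq_in_all ez). Qed.

Lemma increasing_all_occupied t : increasing (@all_occupied R d t).
Proof.
move=> eta zeta ez; rewrite ler_nat; case: allP => // et.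
by case: allP => // -[] x /et; exact/implyP.
Qed.

Lemma pivot_split x phi eta :
  phi eta = phi (set_at x false eta) +
    (eta x)%:R * (phi (set_at x true eta) - phi (set_at x false eta)).
Proof.
rewrite -[in LHS](set_at_id x eta); case: (eta x); first by rewrite mul1r subrKC.
by rewrite mul0r addr0.
Qed.

Lemma all_occupied_split x t phi eta :
  all_occupied R t eta * phi eta = all_occupied R t eta * phi (set_at x false eta) +
  all_occupied R (x :: t) eta * (phi (set_at x true eta) - phi (set_at x false eta)).
Proof.
by rewrite [in LHS](@pivot_split x phi) mulrDr mulrA /all_occupied /= -natrM mulnb andbC.
Qed.

(* Increasing local functions span all local functions: peeling off one site at
   a time writes a local function in the monomials [all_occupied t]. *)
Lemma local_ind (V : (config d -> R) -> Prop) :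
  (forall c phi psi, is_local phi -> is_local psi -> V phi -> V psi ->
    V (fun eta => c * phi eta + psi eta)) ->
  (forall t, V (all_occupied R t)) ->
  forall phi, is_local phi -> V phi.
Proof.
move=> Vlin Vmono phi /is_localP[s].
have V0 : V (fun=> 0).
  have := Vlin (-1) _ _ (depends_local (@depends_all_occupied [::]))
    (depends_local (@depends_all_occupied [::])) (Vmono [::]) (Vmono [::]).
  by congr V; apply/funext => eta; rewrite mulN1r addNr.
suff H : forall t, depends s phi -> V (fun eta => all_occupied R t eta * phi eta).
  move=> /(H [::]); congr V; apply/funext => eta.
  by rewrite /all_occupied /= mul1r.
elim: s phi => [|x s IH] phi t sphi.
  have := Vlin (phi point) _ _ (depends_local (@depends_all_occupied t))
    (local_cst 0) (Vmono t) V0.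
  congr V; apply/funext => eta; rewrite addr0 mulrC; congr (_ * _).
  exact: sphi.
have d0 := depends_set_at false sphi; have d1 := depends_set_at true sphi.
have dD : depends s (fun eta => phi (set_at x true eta) - phi (set_at x false eta)).
  by move=> eta zeta ez; rewrite (d0 _ _ ez) (d1 _ _ ez).
have lmul u psi : depends s psi -> is_local (fun eta => all_occupied R u eta * psi eta).
  move=> spsi; apply: (local_comp2 ( *%R )); apply: depends_local.
    exact: depends_all_occupied.
  exact: spsi.
have := Vlin 1 _ _ (lmul t _ d0) (lmul (x :: t) _ dD) (IH _ t d0) (IH _ (x :: t) dD).
by congr V; apply/funext => eta; rewrite mul1r -all_occupied_split.
Qed.

End local_induction.

(** * Compactness and continuous functions *)

Section config_topology.
Context {d : nat}.
Implicit Types (s t : seq (site d)) (eta zeta : config d) (A B : set (config d)).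

Lemma config_compact : compact [set: config d].
Proof.
have := @tychonoff _ (fun _ : site d => _) _ (fun=> bool_compact).
by congr (compact _); rewrite eqEsubset.
Qed.

Lemma nbhs_agree s eta : nbhs eta [set zeta : config d | {in s, zeta =1 eta}].
Proof.
elim: s => [|x s IH]; first by apply: filterS filterT => zeta _ y; rewrite in_nil.
have xn : nbhs eta [set zeta : config d | zeta x = eta x].
  have := @proj_continuous _ (fun _ : site d => bool) x eta [set eta x].
  by apply; exact: discrete_set1.
apply: filterS (filterI xn IH) => zeta [/= zx zs] y.
by rewrite inE => /predU1P[->|/zs].
Qed.

Lemma local_open A : is_local A -> open A.
Proof.
move=> /is_localP[s sA]; rewrite openE => eta Aeta.
apply: filterS (nbhs_agree s eta) => zeta /= ez.
by rewrite (sA _ _ ez).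
Qed.

Lemma local_setC A : is_local A -> is_local (~` A).
Proof. exact: (@local_comp _ _ _ not). Qed.

Lemma local_setU A B : is_local A -> is_local B -> is_local (A `|` B).
Proof. exact: (@local_comp2 _ _ _ _ or). Qed.

Lemma local_closed A : is_local A -> closed A.
Proof. by move=> /local_setC/local_open/open_closedC; rewrite setCK. Qed.

Lemma config_cover (I : choiceType) (A : set (config d)) (f : I -> set (config d)) :
  closed A -> (forall i, open (f i)) -> A `<=` \bigcup_i f i ->
  exists r : seq I, forall eta, A eta -> exists2 i, i \in r & f i eta.
Proof.
move=> cA fo Af; have : compact A by exact: (subclosed_compact cA config_compact).
rewrite compact_cover => /(_ I setT f (fun i _ => fo i) Af)[D _ AD].
by exists (enum_fset D) => eta /AD[i /= Di fi]; exists i.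
Qed.

Lemma local_cover A (B : nat -> set (config d)) :
  is_local A -> (forall n, is_local (B n)) -> A `<=` \bigcup_n B n ->
  exists N, A `<=` \big[setU/set0]_(n < N) B n.
Proof.
move=> lA lB AB.
have [r rP] := config_cover (local_closed lA) (fun n => local_open (lB n)) AB.
exists (\max_(n <- r) n).+1 => eta /rP[n nr Bn].
rewrite -bigcup_mkord; exists n => //=; rewrite ltnS.
exact: (@leq_bigmax_seq _ r xpredT id n).
Qed.

(** Cylinders form a neighbourhood base. Compactness gives this without unfolding the product
    topology: every configuration outside [U] disagrees with [eta] somewhere, and finitely many
    sites of disagreement suffice for the whole closed complement. *)
Lemma nbhs_config (U : set (config d)) eta : open U -> U eta ->
  exists s, forall zeta, {in s, zeta =1 eta} -> U zeta.
Proof.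
move=> oU Ueta.
have lD x : is_local [set zeta : config d | zeta x <> eta x].
  by apply: (@depends_local _ _ [:: x]) => z z' /(_ x); rewrite inE eqxx => /(_ isT) /= ->.
have [|||r rP] := @config_cover _ (~` U)
    (fun x => [set zeta : config d | zeta x <> eta x]).
- exact: open_closedC.
- by move=> x; apply: local_open; exact: lD.
- move=> zeta /= nU; apply: contrapT => H; apply: nU.
  suff -> : zeta = eta by [].
  by apply/funext => x; apply: contrapT => zx; apply: H; exists x.
by exists r => zeta zr; apply: contrapT => /rP[x xr]; apply; exact: zr.
Qed.

End config_topology.

(** * Continuous functions: approximation by local ones, measurability, integrability *)

Section continuous_functions.
Context {R : realType} {d : nat}.
Implicit Types (s t : seq (site d)) (eta zeta : config d) (f phi : config d -> R).

Lemma local_continuous phi : is_local phi -> continuous phi.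
Proof.
move=> /is_localP[s sphi] eta U /nbhs_singleton Ueta.
apply: filterS (nbhs_agree s eta) => zeta /= ez.
by rewrite /= (sphi _ _ ez).
Qed.

(** Finitely many cylinders on which [f] varies by less than [e / 2] from its central value cover
    the space; the union of their supports serves for all configurations at once. *)
Lemma unif_continuous f (e : R) : continuous f -> 0 < e ->
  exists s, forall eta zeta, {in s, eta =1 zeta} -> `|f eta - f zeta| < e.
Proof.
move=> cf e0; have e2 : 0 < e / 2 by rewrite divr_gt0.
have loc eta : exists s, forall zeta, {in s, zeta =1 eta} -> `|f zeta - f eta| < e / 2.
  apply: (@nbhs_config d [set zeta : config d | `|f zeta - f eta| < e / 2]); last first.
    by rewrite /= subrr normr0.
  have -> : [set zeta : config d | `|f zeta - f eta| < e / 2] = f @^-1` (ball (f eta) (e / 2)).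
    by apply/seteqP; split => zeta; rewrite /ball /= distrC.
  apply: open_comp => [zeta _|]; [exact: cf|exact: ball_open].
pose s eta := sval (cid (loc eta)).
have sP eta zeta : {in s eta, zeta =1 eta} -> `|f zeta - f eta| < e / 2.
  exact: (svalP (cid (loc eta))).
have [|||r rP] := @config_cover d _ setT
    (fun eta => [set zeta : config d | {in s eta, zeta =1 eta}]).
- exact: closedT.
- move=> eta; apply: local_open; apply: (@depends_local _ _ (s eta)) => z z' zz.
  by apply/propext; split => H x xs; [rewrite -zz|rewrite zz] => //; exact: H.
- by move=> eta _; exists eta.
exists (flatten [seq s eta | eta <- r]) => eta zeta ez.
have [xi xir /= xieta] := rP eta I.
have xizeta : {in s xi, zeta =1 xi}.
  move=> x xs; rewrite -xieta// ez//; apply/flatten_mapP; by exists xi.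
have := sP _ _ xieta; have := sP _ _ xizeta.
rewrite (_ : f eta - f zeta = (f eta - f xi) - (f zeta - f xi)); last by lra.
move=> h1 h2; apply: le_lt_trans (ler_normB _ _) _; lra.
Qed.

(** The approximant evaluates [f] after emptying all sites outside [s]. Emptying sites is a monotone
    map, hence the last clause. *)
Lemma local_approx f (e : R) : continuous f -> 0 < e ->
  exists phi, [/\ is_local phi, forall eta, `|f eta - phi eta| <= e &
    (increasing f -> increasing phi)].
Proof.
move=> cf /(unif_continuous cf)[s sf].
exists (fun eta => f (fun x => (x \in s) && eta x)); split.
- by apply: (@depends_local _ _ s) => eta zeta ez; congr f; apply/funext => x;
    case: (boolP (x \in s)) => //= /ez ->.
- by move=> eta; apply/ltW/sf => x ->.
- by move=> fi eta zeta ez; apply: fi => x; case: (x \in s) => //=; exact: ez.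
Qed.

Lemma local_bounded phi : is_local phi -> exists M, forall eta, `|phi eta| <= M.
Proof.
move: phi; apply: local_ind => [c phi psi _ _ [M HM] [N HN]|t].
  exists (`|c| * M + N) => eta; apply: le_trans (ler_normD _ _) _.
  by rewrite normrM lerD// ler_wpM2l.
by exists 1 => eta; rewrite /all_occupied; case: all; rewrite ?normr1 ?normr0.
Qed.

Lemma continuous_bounded f : continuous f -> exists M, forall eta, `|f eta| <= M.
Proof.
move=> cf; have [phi [/local_bounded[M HM] fphi _]] := local_approx cf ltr01.
exists (1 + M) => eta; rewrite -[f eta](subrK (phi eta)).
by apply: le_trans (ler_normD _ _) _; rewrite lerD.
Qed.

Lemma measurable_all_occupied t : measurable [set eta : config d | all eta t].
Proof.
elim: t => [|x t IH] /=; first by rewrite (_ : [set _ | _] = setT) //; apply/seteqP; split.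
have mx : measurable [set eta : config d | eta x].
  by apply: sub_sigma_algebra; exists x.
rewrite (_ : [set _ | _] = [set eta : config d | eta x] `&` [set eta : config d | all eta t]).
  exact: measurableI.
by apply/seteqP; split => eta /=; [move/andP|move=> ?; exact/andP].
Qed.

Lemma all_occupied_indic t : all_occupied R t = \1_[set eta : config d | all eta t].
Proof.
apply/funext => eta; rewrite indicE /all_occupied; congr (_%:R); congr nat_of_bool.
by apply/idP/idP => [?|/set_mem//]; exact/mem_set.
Qed.

Lemma local_indic (A : set (config d)) : is_local A -> is_local (\1_A : config d -> R).
Proof.
move=> lA; rewrite (_ : \1_A = fun eta => (if asbool (A eta) then 1 else 0)).
  exact: (@local_comp _ _ _ (fun P : Prop => if asbool P then 1 else 0 : R)).
apply/funext => eta; rewrite indicE.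
by case: asboolP => [/mem_set ->//|nA]; rewrite memNset.
Qed.

Lemma local_measurable phi : is_local phi -> measurable_fun setT phi.
Proof.
move: phi; apply: local_ind => [c phi psi _ _ mphi mpsi|t].
  apply: measurable_funD => //; apply: measurable_funM => //; exact: measurable_cst.
by rewrite all_occupied_indic; exact: measurable_indic (measurable_all_occupied t).
Qed.

Lemma local_measurable_set (A : set (config d)) : is_local A -> measurable A.
Proof.
move=> /local_indic lA; have := local_measurable lA measurableT (measurable_set1 1).
rewrite setTI; congr measurable; apply/seteqP; split => eta /=; rewrite indicE.
  by case: (boolP (eta \in A)) => [/set_mem//|_ /eqP]; rewrite eq_sym oner_eq0.
by move=> /mem_set ->.
Qed.

(** Continuous functions are pointwise limits of local ones, so measurability for the product
    sigma-algebra follows without identifying it with the Borel one. *)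
Lemma continuous_measurable f : continuous f -> measurable_fun setT f.
Proof.
move=> cf.
have e0 n : 0 < n.+1%:R^-1 :> R by rewrite invr_gt0.
pose g n := sval (cid (local_approx cf (e0 n))).
have gP n := svalP (cid (local_approx cf (e0 n))).
apply: (measurable_fun_cvg (h := g)).
  by move=> n; have [/local_measurable] := gP n.
move=> eta _; apply/cvgrPdist_le => e e1.
near=> n; have [_ + _] := gP n => /(_ eta) /le_trans; apply.
apply/ltW; near: n; exact: (near_infty_natSinv_lt (PosNum e1)).
Unshelve. all: by end_near. Qed.

Lemma continuous_integrable (mu : probability (config d) R) f :
  continuous f -> mu.-integrable setT (EFin \o f).
Proof.
move=> cf; have [M fM] := continuous_bounded cf.
apply: measurable_bounded_integrable => //.
- by rewrite -ge0_fin_numE// fin_num_measure.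
- exact: continuous_measurable.
- exists M; split; first by rewrite num_real.
  by move=> N MN eta _ /=; apply: (le_trans (fM eta)); exact: ltW.
Qed.

End continuous_functions.

(** * Probabilities from states on local functions *)

Definition local_linear (R : realType) d (F : (config d -> R) -> R) :=
  forall (c : R) (phi psi : config d -> R), is_local phi -> is_local psi ->
  F (fun eta => c * phi eta + psi eta) = c * F phi + F psi.

(** The functional form of a consistent family of finite-dimensional distributions. The values of
    [E] off the local functions are unconstrained. *)
Record local_state (R : realType) d (E : (config d -> R) -> R) : Prop := LocalState {
  local_state_linear : local_linear E;
  local_state_ge0 : forall phi : config d -> R, is_local phi ->
    (forall eta, 0 <= phi eta) -> 0 <= E phi;
  local_state_one : E (fun=> 1) = 1 }.

(* The configurations with the algebra of local sets. *)
Definition local_algebra d := config d.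

HB.instance Definition _ d := Pointed.on (local_algebra d).
HB.instance Definition _ d :=
  isAlgebraOfSets.Build default_measure_display (local_algebra d)
    (local_cst False) (@local_setU d) (@local_setC d).

(* A content must be nonnegative on every set, including the non-local ones, on
   whose indicators [E] is arbitrary. *)
Definition local_content (R : realType) d (E : (config d -> R) -> R)
  (A : set (local_algebra d)) : \bar R := (Num.max 0 (E \1_A))%:E.

Section local_state.
Context {R : realType} {d : nat} (E : (config d -> R) -> R) (hE : local_state E).
Implicit Types (eta zeta : config d) (phi psi : config d -> R) (A : set (config d)).

Lemma local_state0 : E (fun=> 0) = 0.
Proof.
have := local_state_linear hE (-1) (local_cst 1) (local_cst 1).
rewrite (local_state_one hE) mulN1r addNr => E0; by rewrite -[RHS]E0.
Qed.

Lemma local_state_cst c : E (fun=> c) = c.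
Proof.
have := local_state_linear hE c (local_cst 1) (local_cst 0).
rewrite (local_state_one hE) local_state0 mulr1 addr0 => E1; rewrite -[RHS]E1.
by congr E; apply/funext => eta; rewrite mulr1 addr0.
Qed.

Lemma local_state_le phi psi : is_local phi -> is_local psi ->
  (forall eta, phi eta <= psi eta) -> E phi <= E psi.
Proof.
move=> lphi lpsi le; rewrite -subr_ge0 -mulN1r addrC -(local_state_linear hE)//.
apply: (local_state_ge0 hE); first exact: (local_comp2 (fun u v => -1 * u + v)).
by move=> eta; rewrite mulN1r addrC subr_ge0.
Qed.

Lemma local_content_local A : is_local A -> local_content E A = (E \1_A)%:E.
Proof.
by move=> lA; rewrite /local_content max_r// (local_state_ge0 hE)//; exact: local_indic.
Qed.

Let content0 : local_content E set0 = 0%E.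
Proof. by rewrite /local_content indic0 local_state0 maxxx. Qed.

Let content_ge0 A : (0 <= local_content E A)%E.
Proof. by rewrite lee_fin le_max lexx. Qed.

Let content_additive : @measure_function.semi_additive _ R (local_algebra d) (local_content E).
Proof.
apply: (additive2P content0).2 => A B lA lB AB.
rewrite !local_content_local//; last exact: local_setU.
rewrite -EFinD; congr EFin.
have lE := local_state_linear hE 1 (local_indic lA) (local_indic lB).
rewrite mul1r in lE; rewrite -lE; congr E.
apply/funext => eta; rewrite mul1r !indicE in_setU.
case: (boolP (eta \in A)) => Aeta; case: (boolP (eta \in B)) => Beta;
  rewrite ?addr0 ?add0r//.
have : set0 eta by rewrite -AB; split; exact/set_mem.
by [].
Qed.

HB.instance Definition _ := isContent.Build _ (local_algebra d) R
  (local_content E) content_ge0 content_additive.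

(* Local sets are clopen, so a countable cover of one by others is finite. *)
Let content_sigma_subadditive :
  @measurable_subset_sigma_subadditive _ R (local_algebra d) (local_content E).
Proof.
move=> A F lF lA AF; have [N AN] := local_cover lA lF AF.
apply: le_trans (nneseries_lim_ge N _) => //; rewrite big_mkord.
by apply: content_subadditive => // k _; exact: lF.
Qed.

HB.instance Definition _ := Content_SigmaSubAdditive_isMeasure.Build _ R
  (local_algebra d) (local_content E) content_sigma_subadditive.

Let premeasure : {measure set (local_algebra d) -> \bar R} := local_content E.
Let ext_type := g_sigma_algebraType (@measurable _ (local_algebra d)).

Let measurable_ext (A : set (config d)) :
  measurable A -> measurable (A : set ext_type).
Proof.
move=> mA; have : <<s @coordinate_sets d >> A by [].
apply: smallest_sub; first exact: smallest_sigma_algebra.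
move=> _ [x ->]; apply: sub_sigma_algebra.
by apply: (@depends_local _ _ [:: x]) => z z' /(_ x); rewrite inE eqxx => /(_ isT) /= ->.
Qed.

(** The Caratheodory extension lives on the sigma-algebra generated by the local sets;
    [measurable_ext] lets it be read on the one generated by the coordinates. *)
Definition state_measure (A : set (config d)) : \bar R :=
  measure_extension premeasure A.

Let state_measure0 : state_measure set0 = 0%E.
Proof. exact: (measure0 (measure_extension premeasure)). Qed.

Let state_measure_ge0 A : (0 <= state_measure A)%E.
Proof. exact: (measure_ge0 (measure_extension premeasure)). Qed.

Let state_measure_sigma_additive : measure_function.semi_sigma_additive state_measure.
Proof.
move=> F mF tF mUF.
apply: (@measure_semi_sigma_additive _ _ _ (measure_extension premeasure)) => //.
  by move=> n; exact: measurable_ext.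
exact: measurable_ext.
Qed.

HB.instance Definition _ := isMeasure.Build _ _ _ state_measure
  state_measure0 state_measure_ge0 state_measure_sigma_additive.

Lemma state_measure_local A : is_local A -> state_measure A = (E \1_A)%:E.
Proof.
move=> lA; rewrite /state_measure /measure_extension.
by rewrite measurable_mu_extE// -local_content_local.
Qed.

Let state_measure_setT : state_measure setT = 1%E.
Proof.
rewrite state_measure_local; last exact: local_cst.
by rewrite indicT (local_state_one hE).
Qed.

HB.instance Definition _ :=
  Measure_isProbability.Build _ _ _ state_measure state_measure_setT.

Lemma state_measure_integral phi : is_local phi ->
  (\int[state_measure]_eta (phi eta)%:E = (E phi)%:E)%E.
Proof.
move: phi; apply: local_ind => [c phi psi lphi lpsi IHphi IHpsi|t].
  have iphi := continuous_integrable state_measure (local_continuous lphi).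
  have ipsi := continuous_integrable state_measure (local_continuous lpsi).
  under eq_integral do rewrite EFinD EFinM.
  rewrite integralD//; last exact: integrableZl.
  by rewrite integralZl// IHphi IHpsi (local_state_linear hE).
have lt : is_local [set eta : config d | all eta t].
  by apply: (@depends_local _ _ t) => eta zeta ez; rewrite /= (eq_in_all ez).
rewrite all_occupied_indic integral_indic//; last exact: (@local_measurable_set R).
by rewrite setIT; exact: state_measure_local.
Qed.

(** The outer measure is an infimum over countable covers by local sets, so a nearly optimal cover
    is what is asked for. *)
Lemma state_measure_outer A (e : R) : measurable A -> 0 < e ->
  exists B : (set (config d))^nat, [/\ forall n, is_local (B n),
    A `<=` \bigcup_n B n & (state_measure (\bigcup_n B n) <= state_measure A + e%:E)%E].
Proof.
move=> mA e0.
have : state_measure A \is a fin_num by rewrite fin_num_measure.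
move=> /(@lb_ereal_inf_adherent _ _ _ e0)[_ [B [lB AB] <-]] Be.
exists B; split=> //; apply: le_trans (ltW Be).
apply: le_trans.
  apply: (measure_sigma_subadditive (state_measure : {measure set (config d) -> \bar R})
    (A := \bigcup_n B n) (F := B)) => //.
    by move=> n; apply: (@local_measurable_set R); exact: lB.
  by apply: bigcup_measurable => n _; apply: (@local_measurable_set R); exact: lB.
apply: lee_nneseries => // n _.
have -> : premeasure (B n) = (E \1_(B n))%:E by exact: local_content_local (lB n).
by rewrite le_eqVlt; apply/orP; left; apply/eqP; exact: state_measure_local (lB n).
Qed.

End local_state.

(** Records the only trace of the construction that is needed later, so that measures can be handed
    over as plain probabilities. *)
Definition outer_regular (R : realType) d (mu : probability (config d) R) :=
  forall (A : set (config d)) (e : R), measurable A -> 0 < e ->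
  exists B : (set (config d))^nat, [/\ forall n, is_local (B n),
    A `<=` \bigcup_n B n & (mu (\bigcup_n B n) <= mu A + e%:E)%E].

Lemma state_probability (R : realType) d (E : (config d -> R) -> R) :
  local_state E -> exists mu : probability (config d) R, outer_regular mu /\
  forall phi : config d -> R, is_local phi -> (\int[mu]_eta (phi eta)%:E = (E phi)%:E)%E.
Proof.
move=> hE; exists (state_measure hE : probability (config d) R); split.
  exact: state_measure_outer.
exact: state_measure_integral.
Qed.

(** * Stochastic domination *)

Section domination.
Context {R : realType} {d : nat}.
Implicit Types (eta zeta : config d) (A K : set (config d)) (mu nu : probability (config d) R).

Definition upper A := forall eta zeta, config_le eta zeta -> A eta -> A zeta.

Definition up_closure K : set (config d) :=
  [set zeta | exists2 eta, K eta & config_le eta zeta].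

(** Having a point of [K] below is decided on the support of [K]: clearing that point outside the
    support keeps it in [K] and leaves order constraints on the support only. *)
Lemma local_up_closure K : is_local K -> is_local (up_closure K).
Proof.
move=> /is_localP[s sK]; apply: (@depends_local _ _ s).
have half z z' : {in s, z =1 z'} -> up_closure K z -> up_closure K z'.
  move=> zz' [eta Keta etaz]; exists (fun x => (x \in s) && eta x).
    rewrite -(sK eta) // => x ->//.
  move=> x; case: (boolP (x \in s)) => //= xs; rewrite -zz'//; exact: etaz.
move=> z z' zz'; apply/propext; split; apply: half => // x xs.
by rewrite zz'.
Qed.

Lemma indic_upper_increasing A : upper A -> increasing (\1_A : config d -> R).
Proof.
move=> uA eta zeta ez; rewrite !indicE ler_nat.
by case: (boolP (eta \in A)) => // /set_mem /(uA _ _ ez) /mem_set ->.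
Qed.

(** Local sets [B n] cover the complement of [A] with excess mass at most [e]. The complements [K m]
    of their finite unions are local, and so are the up-closures [U m], which the hypothesis
    compares. The [U m] decrease to a subset of [A] and each contains the complement of all the
    [B n], whose [mu]-mass is at least [mu A - e]. *)
Lemma le_upper_set mu nu A : outer_regular mu ->
  (forall phi : config d -> R, is_local phi -> increasing phi ->
    (\int[mu]_eta (phi eta)%:E <= \int[nu]_eta (phi eta)%:E)%E) ->
  measurable A -> upper A -> (mu A <= nu A)%E.
Proof.
move=> regmu le_mu_nu mA uA; apply/lee_addgt0Pr => e e0.
have [B [lB AB Be]] := regmu _ _ (measurableC mA) e0.
have mB n : measurable (B n) by exact: (@local_measurable_set R).
have mUB : measurable (\bigcup_n B n) by exact: bigcup_measurable.
pose K m := ~` \big[setU/set0]_(n < m) B n.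
have lK m : is_local (K m).
  apply: local_setC; elim: m => [|m IH]; first by rewrite big_ord0; exact: local_cst.
  by rewrite big_ord_recr; exact: local_setU.
pose U m := up_closure (K m).
have lU m : is_local (U m) by exact: local_up_closure.
have mU m : measurable (U m) by exact: (@local_measurable_set R).
have uU m : upper (U m).
  move=> eta zeta ez [xi Kxi xieta]; exists xi => // x.
  by apply/implyP => xix; apply: (implyP (ez x)); exact: (implyP (xieta x)).
(* The configurations below [zeta] form a closed set. If [zeta] is not in [A], none of them is, so
   finitely many [B n] cover them and some [K m] contains none of them. *)
have UA : \bigcap_m U m `<=` A.
  move=> zeta Uzeta; apply: contrapT => nA.
  pose F := [set eta : config d | config_le eta zeta].
  have FB : F `<=` \bigcup_n B n.
    move=> eta ez; apply: AB => Aeta; apply: nA; exact: uA ez Aeta.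
  have cF : closed F.
    rewrite (_ : F = \bigcap_x [set eta : config d | eta x ==> zeta x]).
      apply: closed_bigI => x _; apply: local_closed.
      apply: (@depends_local _ _ [:: x]) => z z' /(_ x).
      by rewrite inE eqxx => /(_ isT) /= ->.
    by apply/seteqP; split => eta H x; [move=> _; exact: H|exact: (H x I)].
  have [r rP] := config_cover cF (fun n => local_open (lB n)) FB.
  have [eta Keta ez] := Uzeta (\max_(n <- r) n).+1 I.
  have [n nr Bn] := rP _ ez; apply: Keta.
  rewrite -bigcup_mkord; exists n => //=; rewrite ltnS.
  exact: (@leq_bigmax_seq _ r xpredT id n).
have leU m : (mu (~` \bigcup_n B n) <= nu (U m))%E.
  apply: (@le_trans _ _ (mu (U m))).
    apply: le_measure; [exact/mem_set/measurableC|exact/mem_set|].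
    move=> eta nB; exists eta => [|x]; last exact: implybb.
    by move=> KB; apply: nB; apply: bigsetU_bigcup KB.
  have := le_mu_nu _ (local_indic (lU m)) (indic_upper_increasing (uU m)).
  by rewrite !integral_indic// !setIT.
have cvgU : nu \o U @ \oo --> nu (\bigcap_m U m).
  apply: nonincreasing_cvg_mu => //.
  - by rewrite -ge0_fin_numE// fin_num_measure.
  - exact: bigcap_measurable.
  - move=> m n mn; apply/subsetPset => zeta [eta Keta ez]; exists eta => // KB.
    apply: Keta; move: KB; rewrite -!bigcup_mkord => -[k /= km Bk].
    by exists k => //=; exact: leq_trans mn.
have : (mu (~` \bigcup_n B n) <= nu A)%E.
  apply: (@le_trans _ _ (nu (\bigcap_m U m))).
    rewrite -(cvg_lim _ cvgU)//; apply: lime_ge; first by apply/cvg_ex; eexists; exact: cvgU.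
    exact: nearW.
  by apply: le_measure; [exact/mem_set/bigcap_measurable|exact/mem_set|].
rewrite probability_setC//; move: Be; rewrite probability_setC//.
have fin (p : probability (config d) R) X : measurable X -> p X = (fine (p X))%:E.
  by move=> mX; rewrite fineK// fin_num_measure.
rewrite (fin mu _ mUB) (fin mu _ mA) (fin nu _ mA).
rewrite -!EFinD !lee_fin; lra.
Qed.

(** Layer-cake formula: the mean is the integral of the upper tail over the positive half-line minus
    that of the lower tail over the negative one. The superlevel sets of an increasing function are
    upper sets, so both tails compare. *)
Lemma dominated_local mu nu : outer_regular mu ->
  (forall phi : config d -> R, is_local phi -> increasing phi ->
    (\int[mu]_eta (phi eta)%:E <= \int[nu]_eta (phi eta)%:E)%E) ->
  dominated mu nu.
Proof.
move=> regmu le_mu_nu f fi imu inu.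
have mf : measurable_fun setT f by case/integrableP: imu => /measurable_EFinP.
have [F Ff] : exists F : {mfun config d >-> R}, F = f :> (_ -> _).
  by exists (mfun_Sub (mem_set mf)); exact: mfun_valP.
have Lmu : (F : _ -> _) \in Lfun mu 1 by rewrite Ff; exact/Lfun1_integrable.
have Lnu : (F : _ -> _) \in Lfun nu 1 by rewrite Ff; exact/Lfun1_integrable.
have := expectation_cdf_ccdf Lnu; have := expectation_cdf_ccdf Lmu.
rewrite !expectation_def Ff => -> ->.
have uF r : upper (F @^-1` `]r, +oo[).
  move=> eta zeta ez /=; rewrite !in_itv/= !andbT Ff => /lt_le_trans; apply.
  exact: fi.
have mF (I : set R) : measurable I -> measurable (F @^-1` I).
  by move=> mI; rewrite -[X in measurable X]setTI; exact: measurable_funP.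
have le_ccdf r : (ccdf (P := mu) F r <= ccdf (P := nu) F r)%E.
  rewrite /ccdf /distribution /pushforward; apply: le_upper_set => //.
  exact: mF.
apply: leeB; apply: ge0_le_integral => //.
- by apply: measurable_funTS; exact: ccdf_measurable.
- by apply: measurable_funTS; exact: ccdf_measurable.
- by apply: measurable_funTS; exact: cdf_measurable.
- by apply: measurable_funTS; exact: cdf_measurable.
- by move=> r _; rewrite !cdf_1_ccdf leeB.
Qed.

End domination.

(** * Hitting probabilities *)

Section steps.
Variable d : nat.
Implicit Types (u v : 'rV[int]_d).

Definition pos_steps : seq 'rV[int]_d := [seq delta_mx 0 k | k <- enum 'I_d].

Definition steps : seq 'rV[int]_d := pos_steps ++ [seq - v | v <- pos_steps].

Lemma pos_stepsP v : reflect (exists k : 'I_d, v = delta_mx 0 k) (v \in pos_steps).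
Proof.
by apply: (iffP mapP) => [[k _ ->]|[k ->]]; exists k => //; rewrite mem_enum.
Qed.

Lemma mem_steps v : (v \in steps) = (v \in pos_steps) || (- v \in pos_steps).
Proof.
rewrite mem_cat; congr orb; apply/mapP/idP => [[u us ->]|vs]; first by rewrite opprK.
by exists (- v) => //; rewrite opprK.
Qed.

Lemma mem_stepsN v : (- v \in steps) = (v \in steps).
Proof. by rewrite !mem_steps opprK orbC. Qed.

Lemma unit_stepP v : unit_step v <-> v \in steps.
Proof.
rewrite mem_steps; split=> [[k []->]|/orP[]/pos_stepsP[k vk]].
- by apply/orP; left; apply/pos_stepsP; exists k.
- by apply/orP; right; rewrite opprK; apply/pos_stepsP; exists k.
- by exists k; left.
- by exists k; right; rewrite -vk opprK.
Qed.

Lemma pos_stepsN v : v \in pos_steps -> - v \notin pos_steps.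
Proof.
move=> /pos_stepsP[k ->]; apply/negP => /pos_stepsP[l].
move=> /matrixP/(_ 0 k); rewrite !mxE !eqxx /=.
by case: (_ == _).
Qed.

Lemma uniq_steps : uniq steps.
Proof.
have up : uniq pos_steps.
  rewrite map_inj_uniq ?enum_uniq// => k l /matrixP/(_ 0 k).
  by rewrite !mxE !eqxx /=; case: eqP.
rewrite cat_uniq up map_inj_uniq ?up ?andbT; last exact: oppr_inj.
by apply/hasPn => _ /mapP[v vs ->]; exact: pos_stepsN.
Qed.

Lemma size_steps : size steps = (2 * d)%N.
Proof.
have sp : size pos_steps = d by rewrite /pos_steps size_map size_enum_ord.
by rewrite size_cat (size_map (fun v => - v)) sp addnn mul2n.
Qed.

Lemma step_neq0 v : v \in steps -> v != 0.
Proof.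
rewrite mem_steps => vs; apply/eqP => v0; move: vs; rewrite v0 oppr0 orbb.
by move=> /[dup] /pos_stepsN; rewrite oppr0 => /negP.
Qed.

End steps.

(** * First-step analysis of the hitting probability of the origin *)

Section hitting.
Context {R : realType} {d : nat} (d0 : (0 < d)%N).
Context {dW : measure_display} {W : measurableType dW} (P : probability W R).
Context (xi : nat -> W -> 'rV[int]_d) (hxi : srw_steps P xi).
Implicit Types (x v : 'rV[int]_d) (p : nat -> 'rV[int]_d).

Let h := hitting_prob P xi.
Let q : R := (2 * d)%:R^-1.

(** The probability of reaching the origin from [x] within [n] steps, as a recursion that does not
    mention the probability space; [prob_hits] makes the identification. *)
Fixpoint hit_before (n : nat) x : R :=
  if x == 0 then 1 else
  if n is n'.+1 then q * \sum_(v <- steps d) hit_before n' (x + v) else 0.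

Let prefix m p := [set w | forall k, (k < m)%N -> xi k w = p k].

(** The walk is placed at [x] at time [m]. Keeping the starting time as a parameter allows
    conditioning on a prefix of the steps without shifting the sequence [xi]. *)
Let hits n m x := [set w | exists2 k, (k <= n)%N & x + \sum_(j < k) xi (m + j)%N w = 0].

Let measurable_sum (f : nat -> W -> 'rV[int]_d) :
  (forall n v, measurable [set w | f n w = v]) ->
  forall k v, measurable [set w | \sum_(j < k) f j w = v].
Proof.
move=> mf; elim=> [|k IH] v.
  case: (eqVneq 0 v) => [<-|v0].
    by rewrite (_ : [set _ | _] = setT) //; apply/seteqP; split => w //= _; rewrite big_ord0.
  rewrite (_ : [set _ | _] = set0) //; apply/seteqP; split => w //=.
  by rewrite big_ord0 => /eqP; rewrite (negbTE v0).
rewrite (_ : [set _ | _] = \bigcup_u ([set w | \sum_(j < k) f j w = u] `&`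
    [set w | f k w = v - u])).
  apply: countable_bigcupT_measurable => [|u]; first exact: countableP.
  exact: measurableI.
apply/seteqP; split => w /=; rewrite big_ord_recr /=.
  by move=> <-; exists (\sum_(j < k) f j w) => //=; split=> //; rewrite addrAC subrr add0r.
by move=> [u _ /= [-> ->]]; rewrite addrC subrK.
Qed.

Let measurable_prefix m p : measurable (prefix m p).
Proof.
rewrite (_ : prefix m p = \bigcap_(k in [set` iota 0 m]) [set w | xi k w = p k]).
  apply: fin_bigcap_measurable => [|k _]; first exact: finite_seq.
  exact: hxi.1.
apply/seteqP; split => w H k; first by rewrite /= mem_iota => /H.
by move=> km; apply: H; rewrite /= mem_iota.
Qed.

Let measurable_hits n m x : measurable (hits n m x).
Proof.
rewrite (_ : hits n m x = \bigcup_(k in [set` iota 0 n.+1])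
    [set w | \sum_(j < k) xi (m + j)%N w = - x]).
  apply: fin_bigcup_measurable => [|k _]; first exact: finite_seq.
  by apply: (@measurable_sum (fun j => xi (m + j)%N)) => j v; exact: hxi.1.
apply/seteqP; split => w [k kn].
  move=> /= /eqP; rewrite addrC addr_eq0 => /eqP E.
  have kI : k \in iota 0 n.+1 by rewrite mem_iota.
  by exists k.
move=> E; exists k; last by rewrite E subrr.
have : k \in iota 0 n.+1 by [].
by rewrite mem_iota.
Qed.

Let prob_prefix m p : (forall k, (k < m)%N -> unit_step (p k)) ->
  P (prefix m p) = (q ^+ m)%:E.
Proof. by move=> /(hxi.2 m p). Qed.

Let extend p m v : nat -> 'rV[int]_d := fun k => if k == m then v else p k.

Let prefix_extend m p v : prefix m.+1 (extend p m v) = prefix m p `&` [set w | xi m w = v].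
Proof.
apply/seteqP; split => w /=.
  move=> H; split=> [k km|]; last by have := H m (ltnSn m); rewrite /extend eqxx.
  by have := H k (ltnW km); rewrite /extend ltn_eqF.
move=> [H E] k; rewrite ltnS leq_eqVlt /extend; case: eqP => [-> _|_ /= km] //.
exact: H.
Qed.

Let unit_step_extend m p v : (forall k, (k < m)%N -> unit_step (p k)) ->
  v \in steps d -> forall k, (k < m.+1)%N -> unit_step (extend p m v k).
Proof.
move=> up vs k; rewrite ltnS leq_eqVlt /extend; case: eqP => [_ _|_ /= /up//].
exact/unit_stepP.
Qed.

Let q_unit : (2 * d)%:R * q = 1.
Proof. by rewrite mulfV// pnatr_eq0 -lt0n muln_gt0. Qed.

(* Almost surely the next step is a unit step, since the [2d] extensions of a
   path carry all its mass. *)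
Let prob_split m p A : (forall k, (k < m)%N -> unit_step (p k)) -> measurable A ->
  P (prefix m p `&` A) =
  (\sum_(v <- steps d) P (prefix m.+1 (extend p m v) `&` A))%E.
Proof.
move=> up mA.
pose D := [set` steps d].
pose F B v := prefix m.+1 (extend p m v) `&` B.
have tF B : trivIset D (F B).
  apply/trivIsetP => u v _ _ uv; rewrite /F !prefix_extend.
  rewrite -subset0 => w [] [] [_ /= xu] _ [] [_ /= xv] _.
  by move: uv; rewrite -xu -xv eqxx.
have mF B v : measurable B -> measurable (F B v) by move=> mB; exact: measurableI.
have split_fin B : measurable B ->
    P (\bigcup_(v in D) F B v) = (\sum_(v <- steps d) P (F B v))%E.
  move=> mB; rewrite measure_fin_bigcup//; [|exact: finite_seq|by move=> v _; exact: mF].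
  by rewrite -fsbig_seq//; exact: uniq_steps.
have mUF : forall B, measurable B -> measurable (\bigcup_(v in D) F B v).
  move=> B mB; apply: fin_bigcup_measurable; first exact: finite_seq.
  by move=> v _; exact: mF.
have sub B : \bigcup_(v in D) F B v `<=` prefix m p `&` B.
  by move=> w [v _ []]; rewrite prefix_extend => -[].
have null : P (prefix m p `\` \bigcup_(v in D) F setT v) = 0%E.
  rewrite measureD//; last 2 first.
    - exact: mUF.
    - by rewrite -ge0_fin_numE// fin_num_measure.
  rewrite (setIidr (B := \bigcup_(v in D) F setT v)); last first.
    by have := @sub setT; rewrite setIT.
  rewrite [X in (_ - X)%E](split_fin _ measurableT) [X in (X - _)%E]prob_prefix//.
  rewrite (eq_big_seq (fun=> (q ^+ m.+1)%:E)) => [|v vs]; last first.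
    by rewrite /F setIT prob_prefix//; exact: unit_step_extend.
  rewrite sumEFin big_const_seq count_predT size_steps iter_addr_0 -mulr_natl exprS mulrA.
  by rewrite q_unit mul1r -EFinB subrr.
rewrite -split_fin//; apply/eqP; rewrite eq_le; apply/andP; split; last first.
  apply: le_measure; [exact/mem_set/mUF|exact/mem_set/measurableI|exact: sub].
have cov : prefix m p `&` A `<=`
    (\bigcup_(v in D) F A v) `|` (prefix m p `\` \bigcup_(v in D) F setT v).
  move=> w [pw Aw]; have [[v Dv [Fv _]]|nF] := pselect ((\bigcup_(v in D) F setT v) w).
    by left; exists v.
  by right.
have mN : measurable (prefix m p `\` \bigcup_(v in D) F setT v).
  by apply: measurableD => //; exact: mUF.
apply: (le_trans (le_measure P _ _ cov)).
- exact/mem_set/measurableI.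
- by apply/mem_set/measurableU => //; exact: mUF.
apply: (le_trans (measureU2 _ _ _)) => //; first exact: mUF.
by rewrite [X in (_ + X)%E]null adde0.
Qed.

(** This is the Markov property in the form that path probabilities give directly: the event after
    time [m] factors from every prefix of unit steps. The induction on [n] extends the prefix by one
    step. *)
Let prob_hits n : forall m p x, (forall k, (k < m)%N -> unit_step (p k)) ->
  P (prefix m p `&` hits n m x) = (q ^+ m * hit_before n x)%:E.
Proof.
have hits0 k m : hits k m 0 = setT.
  by apply/seteqP; split => // w _; exists 0%N => //; rewrite big_ord0 addr0.
elim: n => [|n IH] m p x up /=.
  case: eqVneq => [->|x0]; first by rewrite hits0 setIT prob_prefix// mulr1.
  rewrite (_ : _ `&` _ = set0) ?measure0 ?mulr0//.
  rewrite -subset0 => w [_ [k]]; rewrite leqn0 => /eqP ->.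
  by rewrite big_ord0 addr0 => /eqP; rewrite (negbTE x0).
case: eqVneq => [->|x0]; first by rewrite hits0 setIT prob_prefix// mulr1.
rewrite prob_split// mulrA -exprSr mulr_sumr -sumEFin; apply: eq_big_seq => v vs.
rewrite -(IH m.+1 (extend p m v)); last exact: unit_step_extend.
congr (P _); apply/seteqP; split => w [pw [k kn]].
  case: k kn => [|k] kn E.
    by move: E x0; rewrite big_ord0 addr0 => ->; rewrite eqxx.
  split=> //; exists k => //; move: E; rewrite big_ord_recl addn0 addrA.
  move: pw; rewrite prefix_extend => -[_ /= ->] E; rewrite -[RHS]E; congr (_ + _).
  by apply: eq_bigr => j _; rewrite addSnnS.
move=> E; split=> //; exists k.+1 => //; rewrite big_ord_recl addn0 addrA.
move: pw; rewrite prefix_extend => -[_ /= ->]; rewrite -[RHS]E; congr (_ + _).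
by apply: eq_bigr => j _; rewrite addSnnS.
Qed.

Let prob_hits0 n x : P (hits n 0 x) = (hit_before n x)%:E.
Proof.
rewrite -[hit_before _ _]mul1r -(expr0 q) -(@prob_hits n 0 (fun=> 0))//.
by congr (P _); apply/seteqP; split=> [w|w []].
Qed.

Let hitE x : [set w | exists n, x + \sum_(m < n) xi m w = 0] = \bigcup_n hits n 0 x.
Proof.
by apply/seteqP; split => w /= [n]; [exists n => //; exists n|move=> _ [k _]; exists k].
Qed.

Let measurable_hit x : measurable (\bigcup_n hits n 0 x).
Proof. exact: bigcup_measurable. Qed.

Lemma hit_before_cvg x : hit_before n x @[n --> \oo] --> h x.
Proof.
suff : (P \o (fun n => hits n 0 x)) n @[n --> \oo] --> (h x)%:E.
  rewrite (_ : _ \o _ = EFin \o (hit_before ^~ x)); first exact: fine_cvg.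
  by apply/funext => n /=; rewrite prob_hits0.
rewrite /h /hitting_prob hitE fineK ?fin_num_measure//.
apply: nondecreasing_cvg_mu => //.
by move=> m n mn; apply/subsetPset => w [k km E]; exists k => //; exact: leq_trans mn.
Qed.

Lemma hitting_prob_ge0 x : 0 <= h x.
Proof. exact/fine_ge0/measure_ge0. Qed.

Lemma hitting_prob_le1 x : h x <= 1.
Proof.
rewrite -lee_fin /h /hitting_prob hitE fineK ?fin_num_measure//.
exact: probability_le1.
Qed.

Lemma hitting_prob0 : h 0 = 1.
Proof.
have c0 := @hit_before_cvg 0.
rewrite -[LHS](cvg_lim (@Rhausdorff R) c0); apply/cvg_lim => //.
rewrite (_ : (fun _ => _) = fun=> 1); first exact: cvg_cst.
by apply/funext => -[|n] /=; rewrite eqxx.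
Qed.

(** The recursion of [hit_before] passes to the limit, the sum over steps being finite. *)
Lemma hitting_prob_harmonic x : x != 0 ->
  \sum_(v <- steps d) (h (x + v) - h x) = 0.
Proof.
move=> x0; rewrite big_split /= sumrN -[X in _ - X]/(\sum_(v <- steps d) h x).
suff -> : h x = q * \sum_(v <- steps d) h (x + v).
  rewrite big_const_seq count_predT size_steps iter_addr_0 -mulr_natl mulrA q_unit.
  by rewrite mul1r subrr.
have c1 := @hit_before_cvg x; rewrite -cvg_shiftS in c1.
rewrite -[LHS](cvg_lim (@Rhausdorff R) c1); apply/cvg_lim => //.
rewrite (_ : [sequence _]_n = fun n => q * \sum_(v <- steps d) hit_before n (x + v)).
  apply: cvgM; first exact: cvg_cst.
  apply: cvg_big => [|v _]; [exact: add_continuous|exact: hit_before_cvg].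
by apply/funext => n /=; rewrite (negbTE x0).
Qed.

Lemma hitting_prob_nbr x : x \in steps d -> q <= h x.
Proof.
move=> xs; suff : q <= hit_before 1 x.
  move=> /le_trans; apply; rewrite -lee_fin -prob_hits0 /h /hitting_prob hitE.
  rewrite fineK ?fin_num_measure//.
  apply: le_measure; [exact/mem_set|exact/mem_set|by move=> w H; exists 1%N].
rewrite /= (negbTE (step_neq0 xs)) ler_peMr// ?invr_ge0//.
rewrite (bigD1_seq (- x)) ?mem_stepsN ?uniq_steps//= subrr eqxx lerDl.
by apply: sumr_ge0 => v _; case: ifP.
Qed.

End hitting.

(** * Boxes and the generator *)

Section lattice.
Context {d : nat}.
Implicit Types (x y z : site d) (s t : seq (site d)).

Definition bond x y := val y - val x \in pos_steps d.

Definition nbr x y := val y - val x \in steps d.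

Lemma nbr_bond x y : nbr x y = bond x y || bond y x.
Proof. by rewrite /nbr mem_steps opprB. Qed.

Lemma nbrC x y : nbr x y = nbr y x.
Proof. by rewrite !nbr_bond orbC. Qed.

Lemma bond_asym x y : bond x y -> ~~ bond y x.
Proof. by move=> /pos_stepsN; rewrite opprB. Qed.

Lemma bond_neq x y : bond x y -> x != y.
Proof.
by move=> bxy; apply/eqP => xy; have := bond_asym bxy; rewrite xy -{1}xy bxy.
Qed.

Lemma bondsE (e : site d * site d) : bonds e <-> bond e.1 e.2.
Proof.
split=> [[k E]|/pos_stepsP[k E]].
  by apply/pos_stepsP; exists k; rewrite E addrAC subrr add0r.
by exists k; rewrite -E addrC subrK.
Qed.

(** One plus the l1 norm. It is at least 1 and changes by at most 1 across a bond; it serves both to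
    index the boxes and to weight the influences. *)
Definition weight x : nat := (\sum_k `|val x 0%R k|).+1.

Lemma weight_nbr x y : nbr x y -> (weight y <= (weight x).+1)%N.
Proof.
move=> /unit_stepP[k E]; rewrite !ltnS.
have yE : val y = val x + (val y - val x) by rewrite addrC subrK.
have le l : (`|val y 0%R l| <= `|val x 0%R l| + (l == k))%N.
  rewrite yE mxE; case: E => ->; rewrite !mxE eqxx /=; case: eqVneq => _ /=; lia.
apply: (@leq_trans (\sum_l (`|val x 0%R l| + (l == k)))%N); first exact: leq_sum.
rewrite big_split /= [X in (_ + X)%N](bigD1 k)//= eqxx.
rewrite [X in (_ + (_ + X))%N]big1 => [|l /negbTE -> //].
by rewrite addn0 addn1.
Qed.

(** The cube only supplies a finite enumeration; membership is governed by [weight] alone, see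
    [mem_box]. *)
Definition box n : seq (site d) :=
  undup [seq x <- pmap insub [seq \row_k ((f k)%:Z - n%:Z) |
    f : {ffun 'I_d -> 'I_(2 * n).+1}] | (weight x <= n)%N].

Lemma uniq_box n : uniq (box n).
Proof. exact: undup_uniq. Qed.

Lemma mem_box n x : (x \in box n) = (weight x <= n)%N.
Proof.
rewrite mem_undup mem_filter; case: leqP => //= wx.
rewrite mem_pmap_sub; apply/mapP.
have bound k : (`|val x 0%R k| <= n)%N.
  apply: leq_trans (ltnW wx); rewrite (bigD1 k)//=; exact: leq_addr.
exists [ffun k => inord (absz (val x 0 k + n%:Z))]; first by rewrite mem_enum.
apply/rowP => k; rewrite !mxE ffunE; move: (val x 0 k) (bound k) => c cn.
have c0 : 0 <= c + n%:Z by lia.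
rewrite inordK ?gez0_abs//; first by rewrite addrK.
by rewrite -ltz_nat gez0_abs//; lia.
Qed.

Lemma sub_box s : exists n, {subset s <= box n}.
Proof.
exists (\max_(x <- s) weight x)%N => x xs; rewrite mem_box.
exact: (@leq_bigmax_seq _ s xpredT weight x).
Qed.

Lemma box_sub m n : (m <= n)%N -> {subset box m <= box n}.
Proof. by move=> mn x; rewrite !mem_box => /leq_trans; apply. Qed.

Lemma box_nbr n x y : x \in box n -> nbr x y -> y \in box n.+1.
Proof. by rewrite !mem_box => xn /weight_nbr /leq_trans; apply. Qed.

Section sums.
Context {V : nmodType}.

(** Each pair of neighbours is oriented in exactly one way by [bond], so the two terms of a bond
    account for its two ordered pairs. *)
Lemma bond_sum_sym s (H : site d -> site d -> V) :
  \sum_(x <- s) \sum_(y <- s | bond x y) (H x y + H y x) =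
  \sum_(x <- s) \sum_(y <- s | nbr x y) H x y.
Proof.
under eq_bigr do rewrite big_split.
rewrite big_split /= [X in _ + X](exchange_big_dep xpredT)//= -big_split /=.
apply: eq_bigr => x _; rewrite !(big_mkcond (fun y => bond _ _)) big_mkcond -big_split /=.
rewrite (big_mkcond (nbr x)); apply: eq_bigr => y _; rewrite nbr_bond.
have := @bond_asym x y; case: (bond x y) => [/(_ isT)/negbTE -> | _] /=.
  by rewrite addr0.
by rewrite add0r.
Qed.

Lemma big_sub_seq s t (F : site d -> V) : uniq s -> uniq t -> {subset s <= t} ->
  \sum_(x <- t | x \in s) F x = \sum_(x <- s) F x.
Proof.
move=> us ut st; rewrite -big_filter; apply: perm_big.
apply: uniq_perm; rewrite ?filter_uniq// => x; rewrite mem_filter.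
by case: (boolP (x \in s)) => //= /st.
Qed.

(* The neighbours of [x] other than the origin, which is not a site. *)
Lemma nbr_sum s x (F : 'rV[int]_d -> V) : uniq s -> (forall y, nbr x y -> y \in s) ->
  \sum_(y <- s | nbr x y) F (val y) =
  \sum_(v <- steps d | val x + v != 0) F (val x + v).
Proof.
move=> us snbr; rewrite -big_filter -(big_map val xpredT F).
rewrite -[RHS]big_filter -(big_map (fun v => val x + v) xpredT F).
apply: perm_big; apply: uniq_perm.
- by rewrite map_inj_uniq ?filter_uniq//; exact: val_inj.
- by rewrite map_inj_uniq ?filter_uniq ?uniq_steps//; exact: addrI.
move=> u; apply/mapP/mapP => [[y]|[v]].
  rewrite mem_filter => /andP[xy ys] ->; exists (val y - val x); last by rewrite addrC subrK.
  by rewrite mem_filter addrC subrK (valP y).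
rewrite mem_filter => /andP[xv0 vs] ->.
exists (Sub (val x + v) xv0 : site d); last by rewrite SubK.
rewrite mem_filter.
have xy : nbr x (Sub (val x + v) xv0 : site d) by rewrite /nbr SubK addrAC subrr add0r.
by rewrite xy snbr.
Qed.

End sums.

Lemma count_nbr s x : uniq s -> (count (nbr x) s <= 2 * d)%N.
Proof.
move=> us; rewrite -size_filter -(size_steps d) -(size_map (fun y => val y - val x)).
apply: uniq_leq_size.
  rewrite map_inj_uniq ?filter_uniq// => y z /addIr; exact: val_inj.
by move=> v /mapP[y]; rewrite mem_filter => /andP[xy _] ->.
Qed.

Lemma sum_nbr_le (R : realType) s x (c : R) : uniq s -> 0 <= c ->
  \sum_(y <- s | nbr x y) c <= (2 * d)%:R * c.
Proof.
move=> us c0; rewrite big_const_seq iter_addr_0 -[leLHS]mulr_natl ler_wpM2r// ler_nat.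
exact: count_nbr.
Qed.

End lattice.

(** * The generator restricted to a finite set of sites *)

Section finite_generator.
Context {R : realType} {d : nat} (a b : R).
Implicit Types (x y z : site d) (s t : seq (site d)) (eta zeta : config d).
Implicit Types (phi psi : config d -> R).

Definition swap x y z := if z == x then y else if z == y then x else z.

Lemma exchangeE x y eta : exchange x y eta = fun z => eta (swap x y z).
Proof. by apply/funext => z; rewrite /exchange /swap; do !case: eqP. Qed.

Lemma exchange_out s x y phi eta : depends s phi -> x \notin s -> y \notin s ->
  phi (exchange x y eta) = phi eta.
Proof.
move=> sphi xs ys; apply: sphi => z zs; rewrite /exchange.
case: eqP => [zx|_]; first by rewrite -zx zs in xs.
by case: eqP => // zy; rewrite -zy zs in ys.
Qed.

Lemma flipE k eta : flip k eta = set_at k (~~ eta k) eta.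
Proof. by apply/funext => j; rewrite /flip /set_at; case: eqP => // ->. Qed.

Lemma flip_out s k phi eta : depends s phi -> k \notin s -> phi (flip k eta) = phi eta.
Proof.
move=> sphi ks; apply: sphi => z zs; rewrite /flip.
by case: eqP => // zk; rewrite -zk zs in ks.
Qed.

Definition bond_sum s (F : site d -> site d -> R) : R :=
  \sum_(x <- s) \sum_(y <- s | bond x y) F x y.

Definition nbr_origin x := val x \in steps d.

(** Births and deaths are written as resetting a spin to a fixed value at a constant rate. Resetting
    to the current value costs nothing, so this agrees with the flips ([flip_rate]), and every
    transition becomes an increasing map with a rate independent of [eta]. *)
Definition box_gen s phi eta : R :=
  bond_sum s (fun x y => phi (exchange x y eta) - phi eta) +
  \sum_(k <- s | nbr_origin k)
    (a * (phi (set_at k false eta) - phi eta) + b * (phi (set_at k true eta) - phi eta)).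

Lemma flip_rate k phi eta :
  (a * (eta k)%:R + b * (1 - (eta k)%:R)) * (phi (flip k eta) - phi eta) =
  a * (phi (set_at k false eta) - phi eta) + b * (phi (set_at k true eta) - phi eta).
Proof.
rewrite flipE; have := set_at_id k eta.
by case: (eta k) => /= ->; rewrite !subrr; lra.
Qed.

(** A bond that misses the support does not change [phi], and a bond that meets it has both ends in
    [t]. *)
Lemma gen_box_gen s t phi eta : uniq t -> depends s phi -> {subset s <= t} ->
  (forall x y, x \in s -> nbr x y -> y \in t) ->
  gen a b phi eta = box_gen t phi eta.
Proof.
move=> ut sphi st nst; rewrite /gen; congr (_ + _).
  pose F e := phi (exchange e.1 e.2 eta) - phi eta.
  pose B := [seq e <- [seq (x, y) | x <- t, y <- t] | bond e.1 e.2].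
  have uB : uniq B.
    by rewrite filter_uniq// allpairs_uniq// => -[? ?] [? ?].
  rewrite -(fsbig_widen [set` B]); last 2 first.
    - by move=> e /=; rewrite mem_filter => /andP[eb _]; exact/bondsE.
    - move=> [x y] [/bondsE/= bxy] /= nB; apply/eqP; rewrite subr_eq0; apply/eqP.
      have nt : ~~ ((x \in t) && (y \in t)).
        apply/negP => /andP[xt yt]; apply: nB; rewrite mem_filter bxy.
        by apply/allpairsP; exists (x, y).
      apply: (exchange_out _ sphi).
        apply: contra nt => xs; rewrite (st _ xs) (nst x)// nbr_bond bxy//.
      by apply: contra nt => ys; rewrite (st _ ys) (nst y)// nbr_bond bxy orbT.
  by rewrite -fsbig_seq// big_filter big_mkcond /= big_allpairs_dep /=;
    apply: eq_bigr => x _; rewrite -big_mkcond.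
rewrite -(fsbig_widen [set` [seq k <- t | nbr_origin k]]); last 2 first.
  - by move=> k /=; rewrite mem_filter => /andP[kn _]; exact/unit_stepP.
  - move=> k [/unit_stepP kn] /= nk; rewrite (flip_out _ sphi) ?subrr ?mulr0//.
    by apply/negP => ks; apply: nk; rewrite mem_filter /nbr_origin kn st.
rewrite -fsbig_seq ?filter_uniq// big_filter; apply: eq_bigr => k _; exact: flip_rate.
Qed.

End finite_generator.

(** * Euler steps in a box *)

Section euler_step.
Context {R : realType} {d : nat} (a b : R) (a0 : 0 <= a) (b0 : 0 <= b).
Variables (s : seq (site d)) (us : uniq s).
Implicit Types (x y z : site d) (eta zeta : config d).
Implicit Types (phi psi : config d -> R) (D : site d -> R).

Definition total_rate : R :=
  bond_sum s (fun _ _ => 1) + \sum_(k <- s | nbr_origin k) (a + b).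

Definition jumps phi eta : R :=
  bond_sum s (fun x y => phi (exchange x y eta)) +
  \sum_(k <- s | nbr_origin k) (a * phi (set_at k false eta) + b * phi (set_at k true eta)).

Definition euler (e : R) phi eta := phi eta + e * box_gen a b s phi eta.

Lemma bond_sumB F G :
  bond_sum s (fun x y => F x y - G x y) = bond_sum s F - bond_sum s G :> R.
Proof. by rewrite /bond_sum; under eq_bigr do rewrite sumrB; rewrite sumrB. Qed.

Lemma bond_sumZ (c : R) F : bond_sum s (fun x y => c * F x y) = c * bond_sum s F.
Proof.
by rewrite /bond_sum; under eq_bigr do rewrite -mulr_sumr; rewrite -mulr_sumr.
Qed.

Lemma ler_bond_sum F G : (forall x y, bond x y -> F x y <= G x y) ->
  bond_sum s F <= bond_sum s G :> R.
Proof. by move=> FG; apply: ler_sum => x _; apply: ler_sum => y; exact: FG. Qed.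

Lemma ler_norm_bond_sum F G : (forall x y, bond x y -> `|F x y| <= G x y) ->
  `|bond_sum s F| <= bond_sum s G :> R.
Proof.
move=> FG; apply: le_trans (ler_norm_sum _ _ _) _; apply: ler_sum => x _.
by apply: le_trans (ler_norm_sum _ _ _) _; apply: ler_sum => y; exact: FG.
Qed.

Lemma total_rate_ge0 : 0 <= total_rate.
Proof.
apply: addr_ge0; apply: sumr_ge0 => x _; last exact: addr_ge0.
exact: sumr_ge0.
Qed.

Lemma box_gen_jumps phi eta : box_gen a b s phi eta = jumps phi eta - total_rate * phi eta.
Proof.
have c1 : bond_sum s (fun _ _ => phi eta) = bond_sum s (fun _ _ => 1) * phi eta.
  rewrite mulrC -bond_sumZ; apply: eq_bigr => x _; apply: eq_bigr => y _.
  by rewrite mulr1.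
have c2 : \sum_(k <- s | nbr_origin k)
      (a * (phi (set_at k false eta) - phi eta) + b * (phi (set_at k true eta) - phi eta)) =
    \sum_(k <- s | nbr_origin k) (a * phi (set_at k false eta) + b * phi (set_at k true eta)) -
    (\sum_(k <- s | nbr_origin k) (a + b)) * phi eta.
  rewrite mulr_suml -sumrB; apply: eq_bigr => k _; ring.
by rewrite /box_gen bond_sumB c1 c2 /jumps /total_rate; ring.
Qed.

Lemma euler_jumps e phi eta :
  euler e phi eta = (1 - e * total_rate) * phi eta + e * jumps phi eta.
Proof. by rewrite /euler box_gen_jumps; ring. Qed.

(* The common estimate behind the sup norm, monotonicity and influence bounds:
   the jump part is a positive combination of transformed copies of [phi]. *)
Lemma le_jumps phi psi eta zeta (B : site d -> site d -> R) (C : site d -> R) :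
  (forall x y, bond x y -> phi (exchange x y eta) - psi (exchange x y zeta) <= B x y) ->
  (forall k v, phi (set_at k v eta) - psi (set_at k v zeta) <= C k) ->
  jumps phi eta - jumps psi zeta <=
    bond_sum s B + \sum_(k <- s | nbr_origin k) (a + b) * C k.
Proof.
move=> HB HC; rewrite /jumps opprD addrACA -bond_sumB -sumrB; apply: lerD.
  exact: ler_bond_sum.
apply: ler_sum => k _; have := HC k true; have := HC k false.
move=> /(ler_wpM2l a0) h1 /(ler_wpM2l b0) h2; lra.
Qed.

Lemma depends_euler e phi : depends s phi -> depends s (euler e phi).
Proof.
move=> sphi eta zeta ez; rewrite !euler_jumps (sphi _ _ ez); congr (_ + e * (_ + _)).
  apply: eq_big_seq => x xs; rewrite big_seq_cond [RHS]big_seq_cond.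
  apply: eq_bigr => y /andP[ys _]; apply: sphi => z zs; rewrite /exchange.
  by case: eqP => _; [exact: ez|case: eqP => _; exact: ez].
rewrite big_seq_cond [RHS]big_seq_cond; apply: eq_bigr => k /andP[ks _].
by congr (_ * _ + _ * _); apply: sphi => z zs; rewrite /set_at; case: eqP => // _; exact: ez.
Qed.

Section small_step.
Variables (e : R) (e0 : 0 <= e) (ets : e * total_rate <= 1).

Let rest0 : 0 <= 1 - e * total_rate. Proof. by rewrite subr_ge0. Qed.

Lemma euler_norm phi M : (forall eta, `|phi eta| <= M) ->
  forall eta, `|euler e phi eta| <= M.
Proof.
(* [le_jumps] is one-sided; comparing [phi] and [- phi] with the zero function gives both bounds. *)
move=> phiM eta; have jM (sgn : R) : `|sgn| = 1 ->
    jumps (fun eta => sgn * phi eta) eta <= total_rate * M.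
  move=> sgn1; have jumps0 : jumps (fun=> 0) eta = 0.
    rewrite /jumps /bond_sum big1 ?add0r => [|x _]; last by rewrite big1.
    by apply: big1 => k _; rewrite !mulr0 addr0.
  rewrite -[leLHS]subr0 -[X in _ - X]jumps0.
  apply: le_trans (le_jumps (B := fun _ _ => M) (C := fun=> M) _ _) _.
  - by move=> x y _; rewrite subr0; apply: le_trans (ler_norm _) _; rewrite normrM sgn1 mul1r.
  - by move=> k v; rewrite subr0; apply: le_trans (ler_norm _) _; rewrite normrM sgn1 mul1r.
  rewrite /total_rate [leRHS]mulrDl; apply: lerD; last by rewrite mulr_suml.
  rewrite mulrC -bond_sumZ.
  by apply: ler_bond_sum => x y _; rewrite mulr1.
have j1 : jumps phi eta <= total_rate * M.
  have := jM 1 (normr1 _); rewrite (_ : (fun eta => 1 * phi eta) = phi) //.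
  by apply/funext => z; rewrite mul1r.
have j2 : - jumps phi eta <= total_rate * M.
  have := jM (-1); rewrite normrN1 => /(_ erefl).
  rewrite (_ : jumps (fun eta => -1 * phi eta) eta = - jumps phi eta) //.
  rewrite /jumps bond_sumZ mulN1r opprD; congr (_ + _).
  by rewrite -sumrN; apply: eq_bigr => k _; ring.
have := phiM eta; rewrite !ler_norml => /andP[p1 p2].
rewrite euler_jumps; apply/andP; split.
  have := ler_wpM2l rest0 p1; have := ler_wpM2l e0 j2; lra.
have := ler_wpM2l rest0 p2; have := ler_wpM2l e0 j1; lra.
Qed.

Lemma euler_increasing phi : increasing phi -> increasing (euler e phi).
Proof.
move=> iphi eta zeta ez; rewrite !euler_jumps lerD//; first exact/ler_wpM2l/iphi.
apply: ler_wpM2l => //; rewrite -subr_le0.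
apply: le_trans (le_jumps (B := fun _ _ => 0) (C := fun=> 0) _ _) _.
- move=> x y _; rewrite subr_le0; apply: iphi => z; rewrite /exchange.
  by case: eqP => _; [exact: ez|case: eqP => _; exact: ez].
- move=> k v; rewrite subr_le0; apply: iphi => z; rewrite /set_at.
  by case: eqP => _; [exact: implybb|exact: ez].
rewrite /bond_sum big1 ?add0r => [|x _]; last by rewrite big1.
by rewrite big1// => k _; rewrite mulr0.
Qed.

Definition influence D phi := forall x eta, `|phi (flip x eta) - phi eta| <= D x.

(** One Euler step of the walk performed by a single site under the exchanges: an exchange carries
    the influence of [z] to [swap x y z], while a reset never increases it. *)
Definition evolve D z := D z + e * bond_sum s (fun x y => D (swap x y z) - D z).

Lemma swapK x y : involutive (swap x y).
Proof.
move=> z; rewrite /swap; case: (eqVneq z x) => [zx|zx].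
  by case: (eqVneq y x) => [yx|_]; rewrite ?eqxx zx.
by case: (eqVneq z y) => [->|zy]; rewrite ?eqxx// (negbTE zx) (negbTE zy).
Qed.

Lemma exchange_flip x y z eta :
  exchange x y (flip z eta) = flip (swap x y z) (exchange x y eta).
Proof.
rewrite !exchangeE; apply/funext => k; rewrite /flip.
by rewrite (can2_eq (swapK x y) (swapK x y)).
Qed.

Lemma set_at_flip k v z eta :
  set_at k v (flip z eta) = set_at k v eta \/
  set_at k v (flip z eta) = flip z (set_at k v eta).
Proof.
case: (eqVneq z k) => [->|zk]; [left|right]; apply/funext => x; rewrite /set_at /flip.
  by case: eqP.
by case: (eqVneq x k) => [->|//]; rewrite eq_sym (negbTE zk).
Qed.

Lemma influence_ge0 D phi x : influence D phi -> 0 <= D x.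
Proof. by move=> /(_ x point); exact: le_trans. Qed.

Lemma influence_euler D phi : influence D phi -> influence (evolve D) (euler e phi).
Proof.
move=> iD z eta.
have D0 := influence_ge0 z iD.
have step eta1 eta2 : (eta1 = flip z eta2 \/ eta2 = flip z eta1) ->
    euler e phi eta1 - euler e phi eta2 <= evolve D z.
  move=> e12.
  have d12 x y : phi (exchange x y eta1) - phi (exchange x y eta2) <= D (swap x y z).
    case: e12 => ->; rewrite exchange_flip; apply: le_trans (ler_norm _) _.
      exact: iD.
    by rewrite distrC; exact: iD.
  have s12 k v : phi (set_at k v eta1) - phi (set_at k v eta2) <= D z.
    apply: le_trans (ler_norm _) _; case: e12 => ->.
      by have [->|->] := set_at_flip k v z eta2; rewrite ?subrr ?normr0.
    by rewrite distrC; have [->|->] := set_at_flip k v z eta1; rewrite ?subrr ?normr0.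
  have p12 : phi eta1 - phi eta2 <= D z.
    by apply: le_trans (ler_norm _) _; case: e12 => ->; [|rewrite distrC]; exact: iD.
  have J : jumps phi eta1 - jumps phi eta2 <= bond_sum s (fun x y => D (swap x y z)) +
      \sum_(k <- s | nbr_origin k) (a + b) * D z.
    by apply: le_jumps => [x y _|k v]; [exact: d12|exact: s12].
  rewrite !euler_jumps /evolve bond_sumB.
  have -> : bond_sum s (fun _ _ => D z) = bond_sum s (fun _ _ => 1) * D z.
    rewrite mulrC -bond_sumZ; apply: eq_bigr => x _; apply: eq_bigr => y _.
    by rewrite mulr1.
  rewrite -mulr_suml in J.
  have := ler_wpM2l rest0 p12; have := ler_wpM2l e0 J; rewrite /total_rate; lra.
by rewrite ler_norml lerNl opprB; apply/andP; split; apply: step; [right|left].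
Qed.

Definition total_influence D : R := \sum_(x <- s) (weight x)%:R * D x.

(** An exchange across a bond moves influence between two sites whose weights differ by at most 1,
    so it adds at most [D x + D y]. A site has at most [2 * d] neighbours, and weights at least 1
    let the sum of [D] be bounded by the weighted sum. *)
Lemma total_influence_evolve D : (forall x, 0 <= D x) ->
  total_influence (evolve D) <= (1 + (2 * d)%:R * e) * total_influence D.
Proof.
move=> D0.
have swap_sum x y : x \in s -> y \in s -> bond x y ->
    \sum_(z <- s) (weight z)%:R * (D (swap x y z) - D z) <= D x + D y.
  move=> xs ys bxy; have xy := bond_neq bxy.
  have one u (c : R) : u \in s -> \sum_(z <- s) (if z == u then c else 0) = c.
    move=> us1; rewrite (bigD1_seq u)//= eqxx big1 ?addr0// => z /negbTE -> //.
  rewrite (eq_bigr (fun z => (if z == x then (weight x)%:R * (D y - D x) else 0) +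
    (if z == y then (weight y)%:R * (D x - D y) else 0))) => [|z _]; last first.
    rewrite /swap; case: (eqVneq z x) => [->|_]; first by rewrite (negbTE xy) addr0.
    by rewrite add0r; case: (eqVneq z y) => [->|_] //; rewrite subrr mulr0.
  rewrite big_split /= !one//.
  have nxy : nbr x y by rewrite nbr_bond bxy.
  have w1 : (weight y)%:R <= (weight x)%:R + 1 :> R.
    by rewrite natr1 ler_nat weight_nbr.
  have w2 : (weight x)%:R <= (weight y)%:R + 1 :> R.
    by rewrite natr1 ler_nat weight_nbr// nbrC.
  have w1' : 0 <= (weight x)%:R + 1 - (weight y)%:R :> R by lra.
  have w2' : 0 <= (weight y)%:R + 1 - (weight x)%:R :> R by lra.
  have := mulr_ge0 w1' (D0 x); have := mulr_ge0 w2' (D0 x).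
  have := mulr_ge0 w1' (D0 y); have := mulr_ge0 w2' (D0 y); lra.
have -> : total_influence (evolve D) = total_influence D +
    e * bond_sum s (fun x y => \sum_(z <- s) (weight z)%:R * (D (swap x y z) - D z)).
  rewrite /total_influence /evolve; under eq_bigr do rewrite mulrDr mulrCA -bond_sumZ.
  rewrite big_split /= -mulr_sumr; congr (_ + _ * _).
  rewrite /bond_sum exchange_big /=; apply: eq_bigr => x _; exact: exchange_big.
rewrite mulrDl mul1r lerD2l mulrAC [leRHS]mulrC ler_wpM2l//.
apply: (@le_trans _ _ (bond_sum s (fun x y => D x + D y))).
  rewrite /bond_sum big_seq_cond [leRHS]big_seq_cond; apply: ler_sum => x /andP[xs _].
  rewrite big_seq_cond [leRHS]big_seq_cond; apply: ler_sum => y /andP[ys bxy].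
  exact: swap_sum.
rewrite /bond_sum (bond_sum_sym s (fun x _ => D x)) /total_influence mulr_sumr.
apply: ler_sum => x _; apply: le_trans (sum_nbr_le x us (D0 x)) _.
by rewrite ler_wpM2l// ler_peMl// ler1n.
Qed.

End small_step.
End euler_step.

(** * Truncation and the semigroup *)

Section truncation.
Context {R : realType} {d : nat} (a b : R).
Implicit Types (x y z : site d) (eta zeta : config d) (s t : seq (site d)).
Implicit Types (phi psi : config d -> R) (D : site d -> R).

Lemma exchangeC x y eta : exchange x y eta = exchange y x eta.
Proof.
apply/funext => z; rewrite /exchange.
by case: (eqVneq z x) => [->|_] //; case: (eqVneq x y) => [->|].
Qed.

(** As [phi] does not see [y], the exchange acts on it either trivially or as a flip at [x]. *)
Lemma exchange_half s x y phi D eta : depends s phi -> influence D phi ->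
  x \in s -> y \notin s -> `|phi (exchange x y eta) - phi eta| <= D x.
Proof.
move=> sphi iD xs ys; case: (eqVneq (eta x) (eta y)) => exy.
  rewrite (_ : exchange x y eta = eta) ?subrr ?normr0; first exact: influence_ge0 iD.
  by apply/funext => z; rewrite /exchange; case: eqP => [->//|_]; case: eqP => [->|].
rewrite (_ : phi (exchange x y eta) = phi (flip x eta)) ?iD//.
apply: sphi => z zs; rewrite /exchange /flip; case: eqP => [->|_].
  by case: (eta x) (eta y) exy => -[].
by case: eqP => // zy; rewrite -zy zs in ys.
Qed.

Lemma big_sub_seq0 s t (P : pred (site d)) (F : site d -> R) :
  uniq s -> uniq t -> {subset s <= t} -> (forall x, x \notin s -> P x -> F x = 0) ->
  \sum_(x <- t | P x) F x = \sum_(x <- s | P x) F x.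
Proof.
move=> us ut st F0; rewrite big_mkcond [RHS]big_mkcond -(big_sub_seq _ us ut st) /=.
rewrite [RHS]big_mkcond; apply: eq_bigr => x _.
by case: (boolP (x \in s)) => // xs; case: ifP => // /(F0 _ xs).
Qed.

Lemma bond_sum_sub s t (F : site d -> site d -> R) :
  uniq s -> uniq t -> {subset s <= t} ->
  bond_sum s F = bond_sum t (fun x y => if (x \in s) && (y \in s) then F x y else 0).
Proof.
move=> us ut st; rewrite /bond_sum (@big_sub_seq0 s t)// => [|x /negbTE xs _]; last first.
  by rewrite big1// => y _; rewrite xs.
rewrite big_seq [RHS]big_seq; apply: eq_bigr => x xs.
rewrite (@big_sub_seq0 s t)// => [|y /negbTE ys _]; last by rewrite ys andbF.
by rewrite big_seq_cond [RHS]big_seq_cond; apply: eq_bigr => y /andP[ys _]; rewrite xs ys.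
Qed.

Lemma gen_box_genS n phi eta : depends (box n) phi ->
  gen a b phi eta = box_gen a b (box n.+1) phi eta.
Proof.
move=> sphi; apply: (gen_box_gen _ _ _ _ sphi); first exact: uniq_box.
- exact: (box_sub (leqnSn n)).
- by move=> x y; exact: box_nbr.
Qed.

(** Only bonds leaving the box are lost. The inner end of such a bond has weight at least [n], so
    its influence is at most [weight x / n] times itself; this produces the factor 1 / n. *)
Lemma gen_truncation n phi D eta : (0 < n)%N -> depends (box n) phi -> influence D phi ->
  `|gen a b phi eta - box_gen a b (box n) phi eta| <=
  (2 * d)%:R / n%:R * total_influence (box n) D.
Proof.
move=> n0 sphi iD; rewrite (gen_box_genS _ sphi).
have D0 x : 0 <= D x by exact: influence_ge0 iD.
have nR : 0 < n%:R :> R by rewrite ltr0n.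
have st : {subset @box d n <= box n.+1} by exact: (box_sub (leqnSn n)).
have us := @uniq_box d n; have ut := @uniq_box d n.+1.
rewrite /box_gen (big_sub_seq0 (s := box n))//; last first.
  move=> k ks _; have E v : phi (set_at k v eta) = phi eta.
    by apply: sphi => z zs; rewrite /set_at; case: eqP => // zk; rewrite -zk zs in ks.
  by rewrite !E subrr !mulr0 addr0.
rewrite opprD addrACA subrr addr0 (bond_sum_sub _ us ut st) -bond_sumB.
pose H x y := if (x \in box n) && (y \notin box n) then D x else 0.
apply: (@le_trans _ _ (bond_sum (box n.+1) (fun x y => H x y + H y x))).
  apply: ler_norm_bond_sum => x y _; rewrite /H.
  case: (boolP (x \in box n)) => xs; case: (boolP (y \in box n)) => ys /=.
  - by rewrite subrr normr0 addr0.
  - by rewrite subr0 addr0; exact: exchange_half xs ys.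
  - by rewrite subr0 add0r exchangeC; exact: exchange_half ys xs.
  - by rewrite (exchange_out _ sphi)// !subrr normr0 addr0.
rewrite /bond_sum bond_sum_sym /total_influence mulr_sumr.
rewrite -(big_sub_seq _ us ut st) [leRHS]big_mkcond; apply: ler_sum => x _.
case: ifPn => xs; last first.
  by rewrite big1// => y _; rewrite /H (negbTE xs).
have c0 : 0 <= (weight x)%:R / n%:R * D x by rewrite mulr_ge0// divr_ge0.
apply: (@le_trans _ _ (\sum_(y <- box n.+1 | nbr x y) ((weight x)%:R / n%:R * D x))).
  apply: ler_sum => y xy; rewrite /H xs /=; case: ifPn => // ys.
  rewrite ler_peMl// ler_pdivlMr// mul1r ler_nat.
  by move: ys; rewrite mem_box -ltnNge => /leq_trans/(_ (weight_nbr xy)).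
apply: le_trans (sum_nbr_le x ut c0) _.
by rewrite le_eqVlt; apply/orP; left; apply/eqP; ring.
Qed.

Lemma local_box phi : is_local phi -> exists n, depends (box n) phi.
Proof.
move=> /is_localP[s sphi]; have [n sn] := sub_box s.
by exists n; exact: dependsW sphi.
Qed.

Lemma depends_box_gen s phi : depends s phi -> depends s (box_gen a b s phi).
Proof.
move=> sphi eta zeta ez; have := depends_euler a b 1 sphi ez.
by rewrite /euler !mul1r (sphi _ _ ez) => /addrI.
Qed.

Lemma local_gen phi : is_local phi -> is_local (gen a b phi).
Proof.
move=> /local_box[n sphi]; apply: (@depends_local _ _ (box n.+1)).
rewrite (_ : gen a b phi = box_gen a b (box n.+1) phi).
  by apply: depends_box_gen; apply: dependsW sphi; exact: (box_sub (leqnSn n)).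
by apply/funext => eta; exact: gen_box_genS.
Qed.

Lemma gen_linear c phi psi eta : is_local phi -> is_local psi ->
  gen a b (fun zeta => c * phi zeta + psi zeta) eta =
  c * gen a b phi eta + gen a b psi eta.
Proof.
move=> /is_localP[s sphi] /is_localP[t tpsi].
have [n stn] := sub_box (s ++ t).
have bphi : depends (box n) phi.
  by apply: dependsW sphi => x xs; apply: stn; rewrite mem_cat xs.
have bpsi : depends (box n) psi.
  by apply: dependsW tpsi => x xs; apply: stn; rewrite mem_cat xs orbT.
rewrite !(@gen_box_genS n)//; last by move=> z z' zz; rewrite (bphi _ _ zz) (bpsi _ _ zz).
rewrite /box_gen mulrDr addrACA -bond_sumZ; congr (_ + _).
  rewrite /bond_sum -big_split; apply: eq_bigr => x _ /=.
  by rewrite -big_split; apply: eq_bigr => y _ /=; ring.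
by rewrite mulr_sumr -big_split; apply: eq_bigr => k _ /=; ring.
Qed.

End truncation.

(** * Contraction and short-time expansion of the semigroup *)

Section semigroup.
Context {R : realType} {d : nat} (a b : R).
Variables (S : R -> (config d -> R) -> config d -> R).
Hypotheses (hS : markov_semigroup S) (hSL : generated_by S (gen a b)).
Implicit Types (eta zeta : config d) (f g phi psi : config d -> R) (c e t M : R).

Lemma continuous_lin c f g : continuous f -> continuous g ->
  continuous (fun eta => c * f eta + g eta).
Proof.
move=> cf cg eta; apply: cvgD; last exact: cg.
by apply: cvgM; [exact: cvg_cst|exact: cf].
Qed.

Lemma continuous_fcst (c : R) : continuous (fun _ : config d => c).
Proof. by move=> eta; exact: cvg_cst. Qed.

Lemma semigroup_cst t c : 0 <= t -> S t (fun=> c) = fun=> c.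
Proof.
move=> t0; have c1 := @continuous_fcst 1.
have S0 : S t (fun=> 0) = fun=> 0.
  have := semigroup_linear hS (-1) t0 c1 c1.
  rewrite (semigroup_one hS t0) => E.
  by rewrite (_ : (fun=> 0) = fun _ : config d => -1 * 1 + 1) ?E//;
    apply/funext => eta; rewrite mulN1r addNr.
have := semigroup_linear hS c t0 c1 (@continuous_fcst 0).
rewrite (semigroup_one hS t0) S0 => E.
rewrite (_ : (fun=> c) = fun _ : config d => c * 1 + 0) ?E//.
by apply/funext => eta; rewrite mulr1 addr0.
Qed.

Lemma semigroup_le t f g : 0 <= t -> continuous f -> continuous g ->
  (forall eta, f eta <= g eta) -> forall eta, S t f eta <= S t g eta.
Proof.
move=> t0 cf cg fg eta.
have cgf := @continuous_lin (-1) _ _ cf cg.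
have : 0 <= S t (fun eta => -1 * f eta + g eta) eta.
  by apply: (semigroup_pos hS) => // zeta; rewrite mulN1r addrC subr_ge0.
by rewrite (semigroup_linear hS)// mulN1r addrC subr_ge0.
Qed.

Lemma semigroup_contraction t f g M : 0 <= t -> continuous f -> continuous g ->
  (forall eta, `|f eta - g eta| <= M) -> forall eta, `|S t f eta - S t g eta| <= M.
Proof.
move=> t0 cf cg fgM eta; have cM := @continuous_fcst M.
have shift (h : config d -> R) : continuous h ->
    S t (fun eta => 1 * h eta + M) eta = S t h eta + M.
  by move=> ch; rewrite (semigroup_linear hS)// semigroup_cst// mul1r.
rewrite ler_distl lerBlDr -!shift//; apply/andP; split.
  apply: semigroup_le => //; first exact: continuous_lin.
  by move=> zeta; have := fgM zeta; rewrite mul1r ler_distl lerBlDr => /andP[].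
apply: semigroup_le => //; first exact: continuous_lin.
by move=> zeta; have := fgM zeta; rewrite mul1r ler_distl => /andP[].
Qed.

Lemma generator_near phi e : is_local phi -> 0 < e -> exists2 delta, 0 < delta &
  forall t, 0 < t < delta -> forall eta,
  `|S t phi eta - phi eta - t * gen a b phi eta| <= e * t.
Proof.
move=> lphi e0; have := hSL lphi.
move=> /(_ [set f | forall eta, `|gen a b phi eta - f eta| < e]) H.
have : nbhs (gen a b phi : {uniform` setT -> R})
    [set f | forall eta, `|gen a b phi eta - f eta| < e].
  apply/uniform_nbhs; exists [set xy | ball xy.1 e xy.2]; split.
    exact: entourage_ball (PosNum e0).
  by move=> f fP eta; exact: fP.
move=> /H; rewrite /= /nbhs /= => -[r /= r0 rP]; exists r => // t /andP[t0 tr] eta.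
have := rP t; rewrite /ball /= sub0r normrN gtr0_norm// => /(_ tr t0 eta) /ltW.
rewrite distrC => le; rewrite -ler_pdivrMr// -[X in _ / X]gtr0_norm// -normf_div.
by rewrite mulrBl mulrAC divff ?gt_eqF// mul1r.
Qed.

Let defect t phi eta := S t phi eta - phi eta - t * gen a b phi eta.

Let defect_linear t c phi psi eta : 0 <= t -> is_local phi -> is_local psi ->
  defect t (fun zeta => c * phi zeta + psi zeta) eta =
  c * defect t phi eta + defect t psi eta.
Proof.
move=> t0 lphi lpsi; rewrite /defect gen_linear// (semigroup_linear hS)//.
  by ring.
all: exact: local_continuous.
Qed.

(* Functions of the spins in [s] form a finite-dimensional space, on which the
   convergence of the difference quotients is uniform. *)
Lemma generator_near_box s e : 0 < e -> exists2 delta, 0 < delta &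
  forall t, 0 < t < delta -> forall phi M, depends s phi ->
  (forall eta, `|phi eta| <= M) -> forall eta,
  `|S t phi eta - phi eta - t * gen a b phi eta| <= e * t * M.
Proof.
suff H : forall u e, 0 < e -> exists2 delta, 0 < delta &
    forall t, 0 < t < delta -> forall phi M, depends s phi ->
    (forall eta, `|phi eta| <= M) -> forall eta,
    `|defect t (fun zeta => all_occupied R u zeta * phi zeta) eta| <= e * t * M.
  move=> /(H [::])[delta delta0 dP]; exists delta => // t td phi M sphi phiM eta.
  have := dP t td phi M sphi phiM eta.
  rewrite (_ : (fun zeta => _) = phi)//.
  by apply/funext => zeta; rewrite /all_occupied mul1r.
elim: s => [|x s IH] u {}e e0.
  have lu := depends_local (@depends_all_occupied R d u).
  have [delta delta0 dP] := generator_near lu e0.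
  exists delta => // t /[dup] td /andP[t0 _] phi M sphi phiM eta.
  rewrite (_ : (fun zeta => _) = fun zeta => phi point * all_occupied R u zeta + 0).
    rewrite defect_linear//; [|exact: ltW|exact: local_cst].
    have -> : defect t (fun=> 0) eta = 0.
      rewrite /defect semigroup_cst ?ltW// subrr sub0r.
      have := @gen_linear R d a b (-1) _ _ eta (local_cst 0) (local_cst 0).
      rewrite (_ : (fun zeta => _) = fun=> 0); last first.
        by apply/funext => zeta; rewrite mulr0 addr0.
      by rewrite mulN1r addNr => ->; rewrite mulr0 oppr0.
    rewrite addr0 normrM [leLHS]mulrC; apply: ler_pM => //; exact: dP.
  apply/funext => zeta; rewrite addr0 mulrC; congr (_ * _); exact: sphi.
(* Peeling off [x] leaves one function bounded by [M] and one bounded by [2 * M]; the errors add up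
   to three quarters of [e * t * M]. *)
have e4 : 0 < e / 4 by rewrite divr_gt0.
have [d1 d10 dP1] := IH u _ e4; have [d2 d20 dP2] := IH (x :: u) _ e4.
exists (Num.min d1 d2); first by rewrite lt_min d10.
move=> t /andP[t0]; rewrite lt_min => /andP[t1 t2] phi M sphi phiM eta.
pose phi0 zeta := phi (set_at x false zeta).
pose psi zeta := phi (set_at x true zeta) - phi (set_at x false zeta).
have s0 : depends s phi0 by exact: depends_set_at.
have spsi : depends s psi.
  move=> z z' zz; rewrite /psi; congr (_ - _);
  by apply: (depends_set_at _ sphi).
have M0 : 0 <= M by apply: le_trans (phiM point).
rewrite (_ : (fun zeta => _) = fun zeta => 1 * (all_occupied R u zeta * phi0 zeta) +
    all_occupied R (x :: u) zeta * psi zeta); last first.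
  by apply/funext => zeta; rewrite mul1r -all_occupied_split.
have lmul v f : depends s f -> is_local (fun zeta => all_occupied R v zeta * f zeta).
  move=> sf; apply: (local_comp2 ( *%R )); last exact: depends_local sf.
  exact/depends_local/depends_all_occupied.
rewrite defect_linear//; [|exact: ltW|exact: lmul|exact: lmul].
rewrite mul1r; apply: le_trans (ler_normD _ _) _.
have h1 := dP1 t (introT andP (conj t0 t1)) _ _ s0 (fun zeta => phiM _) eta.
have psiM zeta : `|psi zeta| <= 2 * M.
  by apply: le_trans (ler_normB _ _) _; have := phiM (set_at x true zeta);
    have := phiM (set_at x false zeta); lra.
have h2 := dP2 t (introT andP (conj t0 t2)) _ _ spsi psiM eta.
have : 0 <= e * t * M by rewrite !mulr_ge0// ltW.
lra.
Qed.

End semigroup.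

(** * Approximation of the semigroup by monotone Euler schemes *)

Section approximation.
Context {R : realType} {d : nat} (a b : R) (a0 : 0 <= a) (b0 : 0 <= b).
Variables (S : R -> (config d -> R) -> config d -> R).
Hypotheses (hS : markov_semigroup S) (hSL : generated_by S (gen a b)).
Implicit Types (eta zeta : config d) (f g phi psi : config d -> R) (c e t M : R).

(** The properties shared by an expectation and by minus an expectation. With [gen_decreasing] they
    let a single estimate serve the upper measure through E' and the lower one through - E. *)
Definition contractive (F : (config d -> R) -> R) :=
  local_linear F /\
  (forall phi M, is_local phi -> (forall eta, `|phi eta| <= M) -> F phi <= M).

Definition gen_decreasing (F : (config d -> R) -> R) :=
  forall psi, is_local psi -> increasing psi -> F (gen a b psi) <= 0.

(* [S t g] is approximated by [k] Euler steps of length [t / k] of the dynamics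
   in a box. *)
Lemma semigroup_approx g t e : is_local g -> 0 <= t -> 0 < e ->
  exists phi, [/\ is_local phi, forall eta, `|S t g eta - phi eta| <= e,
    (increasing g -> increasing phi) &
    forall F, contractive F -> gen_decreasing F -> increasing g -> F phi <= F g + e].
Proof.
move=> lg; rewrite le_eqVlt => /predU1P[<- e0|t0 e0].
  exists g; split=> // [eta|F _ _ _]; last by rewrite lerDl ltW.
  by rewrite (semigroup_zero hS) ?subrr ?normr0; [exact: ltW|exact: local_continuous].
have [M gM] := local_bounded lg.
have M0 : 0 <= M by exact: le_trans (gM point).
have [s0 us0 sg] : exists2 s, uniq s & depends s g.
  have [n ng] := local_box lg; exists (box n) => //; exact: uniq_box.
pose D0 x : R := if x \in s0 then 2 * M else 0.
have D00 x : 0 <= D0 x by rewrite /D0; case: ifP => // _; rewrite mulr_ge0.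
have iD0 : influence D0 g.
  move=> x eta; rewrite /D0; case: ifPn => xs; last by rewrite (flip_out _ sg)// subrr normr0.
  by apply: le_trans (ler_normB _ _) _; have := gM eta; have := gM (flip x eta); lra.
pose W0 := total_influence s0 D0.
have W0_ge0 : 0 <= W0 by apply: sumr_ge0 => x _; rewrite mulr_ge0.
have W0_box n : {subset s0 <= box n} -> total_influence (box n) D0 = W0.
  move=> sn; rewrite /W0 /total_influence.
  have := @big_sub_seq0 R d s0 (box n) xpredT
    (fun x => (weight x)%:R * D0 x) us0 (uniq_box n) sn.
  by apply=> x xs _; rewrite /D0 (negbTE xs) mulr0.
(* Bounds the weighted influence of every iterate up to time [t], uniformly in the box and in the
   number of steps. *)
pose A := expR ((2 * d)%:R * t) * W0.
have A0 : 0 <= A by rewrite mulr_ge0// expR_ge0.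
(* The box is chosen so that truncation costs at most [e / 2] over the whole time [t]. *)
have [n [n0 sn nA]] : exists n, [/\ (0 < n)%N, {subset s0 <= box n} &
    (2 * d)%:R / n%:R * A <= e / (2 * t)].
  have [m sm] := sub_box s0.
  pose B := (2 * d)%:R * A * (2 * t) / e.
  have B0 : 0 <= B by rewrite divr_ge0 ?mulr_ge0// ltW.
  exists (m + Num.bound B).+1; split=> //.
    by move=> x /sm; apply: box_sub; rewrite -addSn ltnW// addSn ltnS leq_addr.
  have nB : B <= (m + Num.bound B).+1%:R.
    apply: (le_trans (ltW (archi_boundP B0))); rewrite ler_nat.
    by rewrite -addSn leq_addl.
  rewrite [leLHS]mulrAC ler_pdivrMr ?ltr0n// [leRHS]mulrAC ler_pdivlMr ?mulr_gt0//.
  by move: nB; rewrite /B ler_pdivrMr// [_%:R * e]mulrC.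
pose s := @box d n.
have us : uniq s := uniq_box n.
pose kappa := (2 * d)%:R / n%:R * A.
have kappa0 : 0 <= kappa by rewrite mulr_ge0// divr_ge0.
(* The other half of the error: [t * e1 * M] is at most [e / 2]; using [M + 1] avoids a zero
   denominator. *)
pose e1 := e / (2 * t * (M + 1)).
have M1 : 0 < M + 1 by rewrite ltr_wpDl.
have e10 : 0 < e1 by rewrite divr_gt0// !mulr_gt0.
have [delta delta0 deltaP] := generator_near_box hS hSL s e10.
pose q := total_rate a b s.
have q0 : 0 <= q by exact: total_rate_ge0.
(* The step must be short both for the expansion of [S tau] and for the Euler step to be a convex
   combination. *)
have [k k0 [tau_delta tau_q]] : exists2 k, (0 < k)%N & t / k%:R < delta /\ t / k%:R * q <= 1.
  pose B := t / delta + t * q.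
  have B0 : 0 <= B by rewrite addr_ge0// ?divr_ge0 ?mulr_ge0// ltW.
  exists (Num.bound B).+1 => //.
  have kB : B < (Num.bound B).+1%:R.
    by apply: (lt_trans (archi_boundP B0)); rewrite ltr_nat.
  have kp : 0 < (Num.bound B).+1%:R :> R by rewrite ltr0n.
  split.
    rewrite ltr_pdivrMr// mulrC -ltr_pdivrMr//.
    by apply: le_lt_trans kB; rewrite lerDl mulr_ge0// ltW.
  rewrite mulrAC ler_pdivrMr// mul1r.
  by apply: le_trans (ltW kB); rewrite lerDr divr_ge0// ltW.
pose tau := t / k%:R.
have tau0 : 0 < tau by rewrite divr_gt0// ltr0n.
have tauk : tau * k%:R = t by rewrite divfK// pnatr_eq0 -lt0n.
pose phi j := iter j (euler a b s tau) g.
have inv j : [/\ depends s (phi j), (forall eta, `|phi j eta| <= M),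
    (increasing g -> increasing (phi j)) &
    exists2 D, influence D (phi j) &
      total_influence s D <= (1 + (2 * d)%:R * tau) ^+ j * W0].
  elim: j => [|j [sj Mj ij [D iD DW]]].
    split=> //; first by apply: dependsW sg.
    by exists D0 => //; rewrite expr0 mul1r /s W0_box.
  split.
  - exact: depends_euler.
  - by apply: euler_norm => //; exact: ltW.
  - by move=> /ij ij'; apply: euler_increasing => //; exact: ltW.
  exists (evolve s tau D); first by apply: (influence_euler a0 b0) => //; exact: ltW.
  have D_ge0 x : 0 <= D x by exact: influence_ge0 iD.
  apply: le_trans (total_influence_evolve us (ltW tau0) D_ge0) _.
  by rewrite exprS -mulrA ler_wpM2l// addr_ge0// mulr_ge0// ltW.
have lphi j : is_local (phi j) by have [/depends_local] := inv j.
have trunc j : (j <= k)%N -> forall eta,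
    `|gen a b (phi j) eta - box_gen a b s (phi j) eta| <= kappa.
  move=> jk eta; have [sj _ _ [D iD DW]] := inv j.
  apply: le_trans (gen_truncation a b eta n0 sj iD) _.
  rewrite ler_wpM2l ?divr_ge0//; apply: le_trans DW _; rewrite ler_wpM2r//.
  (* By 1 + u <= exp u, at most [k] steps of length [t / k] give growth at most exp (2 d t). *)
  have : (1 + (2 * d)%:R * tau) ^+ j <= expR ((2 * d)%:R * tau) ^+ j.
    by rewrite lerXn2r ?nnegrE ?expR_ge0 ?addr_ge0 ?mulr_ge0 ?expR_ge1Dx// ltW.
  move=> /le_trans; apply; rewrite -expRM_natl ler_expR mulrCA ler_wpM2l//.
  by rewrite -tauk mulrC ler_wpM2l ?ler_nat// ltW.
pose c := e1 * M + kappa.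
have ct : t * c <= e.
  have -> : e = t * (e / (2 * t) + e / (2 * t)).
    by field; rewrite gt_eqF.
  apply: ler_wpM2l; [exact: ltW|apply: lerD => //].
  rewrite /e1 -mulrA; apply: ler_wpM2l; first exact: ltW.
  rewrite invfM -mulrA ler_piMr ?invr_ge0 ?mulr_ge0//; first exact: ltW.
  by rewrite mulrC ler_pdivrMr// mul1r lerDl.
(* In each step [S tau] does not increase the earlier error, the short-time expansion costs
   [e1 * M * tau] and the truncation [kappa * tau]. *)
have close j : (j <= k)%N -> forall eta, `|S (tau * j%:R) g eta - phi j eta| <= tau * j%:R * c.
  elim: j => [_ eta|j IH jk eta].
    by rewrite !mulr0 mul0r (semigroup_zero hS) ?subrr ?normr0//; exact: local_continuous.
  have [sj Mj _ _] := inv j.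
  have cg : continuous g by exact: local_continuous.
  have cphi : continuous (phi j) by exact: local_continuous.
  have tj : 0 <= tau * j%:R by rewrite mulr_ge0// ltW.
  have -> : S (tau * j.+1%:R) g = S tau (S (tau * j%:R) g).
    rewrite -(semigroup_add hS (ltW tau0) tj cg); congr (S _ g).
    by rewrite -natr1 mulrDr mulr1 addrC.
  have h1 := semigroup_contraction hS (ltW tau0)
    (semigroup_continuous hS tj cg) cphi (IH (ltnW jk)) eta.
  have td : 0 < tau < delta by rewrite tau0.
  have h2 := deltaP tau td _ _ sj Mj eta.
  have h3 := trunc j (ltnW jk) eta.
  have E : phi j.+1 eta = phi j eta + tau * box_gen a b s (phi j) eta by [].
  rewrite E.
  have := ler_wpM2l (ltW tau0) h3.
  rewrite -[X in X * `|_|](ger0_norm (ltW tau0)) -normrM => h4.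
  rewrite (_ : S _ _ eta - _ = (S tau (S (tau * j%:R) g) eta - S tau (phi j) eta) +
    (S tau (phi j) eta - phi j eta - tau * gen a b (phi j) eta) +
    tau * (gen a b (phi j) eta - box_gen a b s (phi j) eta)); last by ring.
  apply: le_trans (ler_normD _ _) _; apply: le_trans (lerD (ler_normD _ _) (lexx _)) _.
  rewrite -natr1 (_ : _ * c = tau * j%:R * c + e1 * tau * M + tau * kappa).
    by apply: lerD => //; exact: lerD.
  by rewrite /c; ring.
exists (phi k); split.
- exact: lphi.
- by move=> eta; have := close k (leqnn k) eta; rewrite tauk => /le_trans; apply.
- by have [] := inv k.
move=> F [Flin Fle] Fgen ig.
(* The iterates are increasing, so [F] is nonpositive on their full generator and gains at most the
   truncation error [kappa] per unit of time. *)
have step j : (j <= k)%N -> F (phi j) <= F g + tau * j%:R * kappa.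
  elim: j => [_|j IH jk]; first by rewrite mulr0 mul0r addr0.
  have [sj _ ij _] := inv j.
  have lb : is_local (box_gen a b s (phi j)).
    by apply: (@depends_local _ _ s); exact: depends_box_gen.
  have lG : is_local (gen a b (phi j)) by exact: local_gen.
  have -> : phi j.+1 = fun eta => tau * box_gen a b s (phi j) eta + phi j eta.
    by apply/funext => eta; rewrite addrC.
  rewrite Flin//.
  have ldiff : is_local (fun eta => -1 * gen a b (phi j) eta + box_gen a b s (phi j) eta).
    exact: (local_comp2 (fun x y => -1 * x + y)).
  have h : F (box_gen a b s (phi j)) <= kappa.
    have := Fle _ kappa ldiff; rewrite Flin// mulN1r => H.
    have := Fgen _ (lphi j) (ij ig).
    have : F (box_gen a b s (phi j)) - F (gen a b (phi j)) <= kappa.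
      rewrite addrC; apply: H => eta; rewrite mulN1r addrC distrC.
      exact: trunc (ltnW jk) eta.
    lra.
  rewrite -natr1 mulrDr mulr1 mulrDl addrA [leRHS]addrC.
  by apply: lerD; [exact: ler_wpM2l (ltW tau0) _ _ h|exact: IH (ltnW jk)].
apply: le_trans (step k (leqnn k)) _; rewrite tauk lerD2l.
apply: le_trans ct; apply: ler_wpM2l; first exact: ltW.
by rewrite lerDr mulr_ge0// ltW.
Qed.

End approximation.

(** * Product measures *)

Section product_state.
Context {R : realType} {d : nat} (alpha : site d -> R).
Hypothesis alpha01 : forall x, 0 <= alpha x <= 1.
Implicit Types (x y i j : site d) (eta zeta : config d) (s t : seq (site d)).
Implicit Types (phi psi : config d -> R) (c : R).

Definition average x phi eta : R :=
  alpha x * phi (set_at x true eta) + (1 - alpha x) * phi (set_at x false eta).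

Definition averages s phi := foldr average phi s.

(* Later sites are averaged last: once [phi] has become constant, further
   averaging leaves it unchanged. *)
Fixpoint exhaust n : seq (site d) := if n is m.+1 then box n ++ exhaust m else [::].

(** Taking a limit avoids choosing a support for each function; for local [phi] the sequence is
    eventually constant, and other functions get an irrelevant value. *)
Definition product_state phi : R := limn (fun n => averages (exhaust n) phi point).

Lemma set_atC x y u v eta : x != y ->
  set_at x u (set_at y v eta) = set_at y v (set_at x u eta).
Proof.
move=> xy; apply/funext => z; rewrite /set_at.
by case: (eqVneq z x) => [->|//]; rewrite (negbTE xy).
Qed.

Lemma set_atK x u v eta : set_at x u (set_at x v eta) = set_at x u eta.
Proof. by apply/funext => z; rewrite /set_at; case: eqP. Qed.

Lemma averageC x y phi : average x (average y phi) = average y (average x phi).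
Proof.
case: (eqVneq x y) => [->//|xy]; apply/funext => eta; rewrite /average.
rewrite (set_atC true true eta xy) (set_atC true false eta xy).
rewrite (set_atC false true eta xy) (set_atC false false eta xy); ring.
Qed.

Lemma averages_average s x phi : averages s (average x phi) = average x (averages s phi).
Proof. by elim: s => //= y s ->; rewrite averageC. Qed.

Lemma average_cst x c : average x (fun=> c) = fun=> c.
Proof. by apply/funext => eta; rewrite /average; ring. Qed.

Lemma averages_cst s c : averages s (fun=> c) = fun=> c.
Proof. by elim: s => //= y s ->; exact: average_cst. Qed.

Lemma averages_cat s t phi : averages (s ++ t) phi = averages s (averages t phi).
Proof. exact: foldr_cat. Qed.

Lemma averages_linear s c phi psi eta :
  averages s (fun zeta => c * phi zeta + psi zeta) eta =
  c * averages s phi eta + averages s psi eta.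
Proof. by elim: s eta => //= x s IH eta; rewrite /average !IH; ring. Qed.

Lemma averages_ge0 s phi : (forall eta, 0 <= phi eta) ->
  forall eta, 0 <= averages s phi eta.
Proof.
move=> phi0; elim: s => //= x s IH eta; have /andP[a0 a1] := alpha01 x.
by rewrite addr_ge0// mulr_ge0// subr_ge0.
Qed.

Lemma depends_average x s phi : depends (x :: s) phi -> depends s (average x phi).
Proof.
move=> sphi eta zeta ez; rewrite /average.
by congr (_ * _ + _ * _); apply: (depends_set_at _ sphi).
Qed.

(** Averaging at a site removes it from the support; once all of [s] is averaged, the starting
    configuration no longer matters. *)
Lemma averages_depends s phi : depends s phi ->
  averages s phi = fun=> averages s phi point.
Proof.
move=> sphi; suff H u : depends [seq x <- s | x \notin u] (averages u phi).
  have := H s; rewrite (_ : [seq _ <- _ | _] = [::]).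
    by move=> d0; apply/funext => eta; exact: d0.
  apply/eqP; rewrite -size_eq0 size_filter -leqn0 leqNgt -has_count.
  by apply/hasPn => x xs; rewrite negbK.
elim: u => [|x u IH] /=; first by rewrite (_ : [seq _ <- _ | _] = s)//; apply/all_filterP/allP.
apply: depends_average; apply: dependsW IH => y; rewrite !inE !mem_filter inE.
by case: eqP => //= _; rewrite negb_or.
Qed.

Lemma mem_exhaust n x : x \in box n -> x \in exhaust n.
Proof. by case: n => [|n]; [rewrite mem_box|rewrite /= mem_cat => ->]. Qed.

Lemma product_state_eventually phi : is_local phi ->
  exists N, forall n, (N <= n)%N -> averages (exhaust n) phi = fun=> product_state phi.
Proof.
move=> /local_box[N Nphi]; exists N.
have cst n : (N <= n)%N -> averages (exhaust n) phi = averages (exhaust N) phi.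
  elim: n => [|n IH]; first by rewrite leqn0 => /eqP ->.
  rewrite leq_eqVlt => /predU1P[->//|]; rewrite ltnS => /IH E.
  have dN : depends (exhaust N) phi by apply: dependsW Nphi; exact: mem_exhaust.
  rewrite [exhaust n.+1]/= (averages_cat (box n.+1)) E.
  by rewrite (averages_depends dN) averages_cst.
have dN : depends (exhaust N) phi by apply: dependsW Nphi; exact: mem_exhaust.
move=> n Nn; rewrite cst// averages_depends//; apply/funext => eta.
rewrite /product_state; apply/esym/cvg_lim => //.
apply: cvg_near_cst; exists N => // m /= Nm; by rewrite cst.
Qed.

Lemma product_local_state : local_state product_state.
Proof.
split=> [c phi psi lphi lpsi|phi lphi phi0|].
- have [N1 E1] := product_state_eventually lphi.
  have [N2 E2] := product_state_eventually lpsi.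
  have [N3 E3] := product_state_eventually (local_comp2 (fun u v => c * u + v) lphi lpsi).
  pose n := (N1 + N2 + N3)%N.
  have := averages_linear (exhaust n) c phi psi point.
  by rewrite E1 ?E2 ?E3//; rewrite /n; lia.
- have [N E] := product_state_eventually lphi.
  by have := averages_ge0 (exhaust N) phi0 point; rewrite E.
- have [N E] := product_state_eventually (local_cst (1 : R)).
  by have := averages_cst (exhaust N) 1; rewrite E// => /(congr1 (@^~ point)).
Qed.

Lemma local_average x phi : is_local phi -> is_local (average x phi).
Proof.
move=> /is_localP[s sphi]; apply: (@depends_local _ _ s).
by apply: depends_average; apply: dependsW sphi => y ys; rewrite inE ys orbT.
Qed.

(** Averages at different sites commute, so any site may be integrated out first. All expectations
    of the bond and birth-death terms are computed in this way. *)
Lemma product_state_average x phi : is_local phi ->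
  product_state (average x phi) = product_state phi.
Proof.
move=> lphi; have [N1 E1] := product_state_eventually lphi.
have [N2 E2] := product_state_eventually (local_average x lphi).
have := averages_average (exhaust (N1 + N2)) x phi.
rewrite E1 ?leq_addr// E2 ?leq_addl// average_cst => /(congr1 (@^~ point)).
by [].
Qed.

Lemma product_state_cylinder s zeta : uniq s ->
  product_state (fun eta => (all (fun i => eta i == zeta i) s)%:R) =
  \prod_(i <- s) (if zeta i then alpha i else 1 - alpha i).
Proof.
elim: s => [_|x s IH /= /andP[xs us]].
  by rewrite big_nil -[RHS](local_state_one product_local_state).
have ls u : is_local (fun eta : config d => (all (fun i => eta i == zeta i) u)%:R : R).
  apply: (@depends_local _ _ u) => eta eta' ee; congr (nat_of_bool _)%:R.
  by apply: eq_in_all => i /ee ->.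
rewrite big_cons -IH// -(product_state_average x); last exact: (ls (x :: s)).
set c := if zeta x then _ else _.
rewrite (_ : average x _ = fun eta => c * (all (fun i => eta i == zeta i) s)%:R + 0).
  rewrite (local_state_linear product_local_state)//; last exact: local_cst.
  by rewrite (local_state0 product_local_state) addr0.
apply/funext => eta; rewrite addr0 /average.
have out v : all (fun i => set_at x v eta i == zeta i) s = all (fun i => eta i == zeta i) s.
  apply: eq_in_all => i is_; rewrite /set_at; case: (eqVneq i x) => [ix|//].
  by rewrite -ix is_ in xs.
rewrite /= !out /set_at eqxx /c.
by case: (zeta x) => /=; rewrite mulr0 ?addr0 ?add0r.
Qed.

End product_state.

Lemma exists_product (R : realType) d (alpha : site d -> R) :
  (forall x, 0 <= alpha x <= 1) ->
  exists nu : probability (config d) R, [/\ outer_regular nu,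
    product_bernoulli alpha nu &
    forall phi : config d -> R, is_local phi ->
      (\int[nu]_eta (phi eta)%:E = (product_state alpha phi)%:E)%E].
Proof.
move=> alpha01.
have [nu [rnu nuE]] := state_probability (product_local_state alpha01).
exists nu; split=> //; split=> // s zeta us.
have ls : is_local [set eta : config d | {in s, eta =1 zeta}].
  apply: (@depends_local _ _ s) => z z' zz; apply/propext; split => H x xs;
  by [rewrite -zz//; exact: H|rewrite zz//; exact: H].
rewrite -(product_state_cylinder alpha01 zeta us) -nuE; last first.
  apply: (@depends_local _ _ s) => eta eta' ee; congr (nat_of_bool _)%:R.
  by apply: eq_in_all => i /ee ->.
rewrite -[in LHS](setIT [set eta : config d | _]) -integral_indic//; last first.
  exact: (@local_measurable_set R).
apply: eq_integral => eta _; rewrite indicE; congr ((nat_of_bool _)%:R%:E).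
apply/idP/allP => [/set_mem ez x xs|ez]; first by rewrite ez.
by apply/mem_set => x xs; exact/eqP/ez.
Qed.

(** * Sign of the generator on product measures *)

Section generator_sign.
Context {R : realType} {d : nat} (a b : R).
Implicit Types (x y k : site d) (eta zeta : config d) (s t : seq (site d)).
Implicit Types (phi psi : config d -> R) (F : (config d -> R) -> R).

Section linear.
Variables (F : (config d -> R) -> R) (F_linear : local_linear F).

Lemma local_linear0 : F (fun=> 0) = 0.
Proof.
have := F_linear (-1) (local_cst 0) (local_cst 0).
rewrite (_ : (fun _ => _) = fun=> 0); first by rewrite mulN1r addNr.
by apply/funext => eta; rewrite mulr0 addr0.
Qed.

Lemma local_linearD phi psi : is_local phi -> is_local psi ->
  F (fun eta => phi eta + psi eta) = F phi + F psi.
Proof.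
move=> lphi lpsi; rewrite -[F phi]mul1r -F_linear//; congr F.
by apply/funext => eta; rewrite mul1r.
Qed.

Lemma local_linearZ c phi : is_local phi -> F (fun eta => c * phi eta) = c * F phi.
Proof.
move=> lphi; have := F_linear c lphi (local_cst 0); rewrite local_linear0 addr0 => <-.
by congr F; apply/funext => eta; rewrite addr0.
Qed.

Lemma local_sum (I : Type) (r : seq I) (P : pred I) (G : I -> config d -> R) :
  (forall i, is_local (G i)) -> is_local (fun eta => \sum_(i <- r | P i) G i eta).
Proof.
move=> lG; elim: r => [|i r IH].
  by rewrite (_ : (fun _ => _) = fun=> 0);
    [exact: local_cst|apply/funext => eta; rewrite big_nil].
rewrite (_ : (fun _ => _) = fun eta => (if P i then G i eta else 0) +
    \sum_(i <- r | P i) G i eta).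
  apply: (local_comp2 +%R) => //; case: (P i) => //; exact: local_cst.
by apply/funext => eta; rewrite big_cons; case: ifP => //; rewrite add0r.
Qed.

Lemma local_linear_sum (I : Type) (r : seq I) (P : pred I) (G : I -> config d -> R) :
  (forall i, is_local (G i)) ->
  F (fun eta => \sum_(i <- r | P i) G i eta) = \sum_(i <- r | P i) F (G i).
Proof.
move=> lG; elim: r => [|i r IH].
  by rewrite big_nil -[RHS]local_linear0; congr F; apply/funext => eta; rewrite big_nil.
rewrite big_cons -IH; case: ifPn => Pi.
  rewrite -local_linearD//; last exact: local_sum.
  by congr F; apply/funext => eta; rewrite big_cons Pi.
by congr F; apply/funext => eta; rewrite big_cons (negbTE Pi).
Qed.

Lemma local_exchange x y phi : is_local phi -> is_local (fun eta => phi (exchange x y eta)).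
Proof.
move=> /is_localP[s sphi]; apply: (@depends_local _ _ (x :: y :: s)) => eta zeta ez.
apply: sphi => z zs; rewrite /exchange.
case: eqP => _; first by apply: ez; rewrite !inE eqxx orbT.
by case: eqP => _; apply: ez; rewrite !inE ?eqxx// zs !orbT.
Qed.

Lemma local_set_at x v phi : is_local phi -> is_local (fun eta => phi (set_at x v eta)).
Proof.
move=> /is_localP[s sphi]; apply: (@depends_local _ _ s).
by apply: depends_set_at; apply: dependsW sphi => y ys; rewrite inE ys orbT.
Qed.

Lemma localB phi psi : is_local phi -> is_local psi -> is_local (fun eta => phi eta - psi eta).
Proof. exact: (local_comp2 (fun u v => u - v)). Qed.

Lemma localZ c phi : is_local phi -> is_local (fun eta => c * phi eta).
Proof. exact: (local_comp (fun u => c * u)). Qed.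

Lemma localD phi psi : is_local phi -> is_local psi -> is_local (fun eta => phi eta + psi eta).
Proof. exact: (local_comp2 +%R). Qed.

(* Summation by parts: collecting at each site the two end terms of its bonds
   leaves [g x] times the sum of the increments of [m] to the neighbours of [x]. *)
Lemma gen_le0 (m : 'rV[int]_d -> R) (g : site d -> R) phi n :
  depends (box n) phi ->
  (forall x, 0 <= g x) -> (forall x, x \notin box n -> g x = 0) ->
  (forall x, \sum_(v <- steps d | val x + v != 0) (m (val x + v) - m (val x)) <= 0) ->
  (forall x y, bond x y -> F (fun eta => phi (exchange x y eta) - phi eta) <=
     (m (val y) - m (val x)) * g x + (m (val x) - m (val y)) * g y) ->
  (forall k, nbr_origin k -> F (fun eta => a * (phi (set_at k false eta) - phi eta) +
     b * (phi (set_at k true eta) - phi eta)) <= 0) ->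
  F (gen a b phi) <= 0.
Proof.
move=> sphi g0 gout sup Fbond Fbirth.
have lphi : is_local phi by exact: depends_local sphi.
have lE x y : is_local (fun eta => phi (exchange x y eta) - phi eta).
  by apply: localB => //; exact: local_exchange.
have lS k v : is_local (fun eta => phi (set_at k v eta) - phi eta).
  by apply: localB => //; exact: local_set_at.
rewrite (_ : gen a b phi = box_gen a b (box n.+1) phi); last first.
  by apply/funext => eta; exact: gen_box_genS.
rewrite /box_gen local_linearD; last 2 first.
- by apply: local_sum => x; exact: local_sum.
- by apply: local_sum => k; apply: localD; exact: localZ.
rewrite -[leRHS]addr0 lerD//; last first.
  rewrite local_linear_sum; first exact: sumr_le0.
  by move=> k; apply: localD; exact: localZ.
rewrite /bond_sum local_linear_sum; last by move=> x; exact: local_sum.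
under eq_bigr do rewrite local_linear_sum//.
pose H x y := (m (val y) - m (val x)) * g x.
apply: (@le_trans _ _ (\sum_(x <- box n.+1) \sum_(y <- box n.+1 | bond x y) (H x y + H y x))).
  by apply: ler_sum => x _; apply: ler_sum => y; exact: Fbond.
rewrite bond_sum_sym; apply: sumr_le0 => x _; rewrite /H -mulr_suml.
case: (boolP (x \in box n)) => [xn|/gout ->]; last by rewrite mulr0.
rewrite mulr_le0_ge0// (nbr_sum (fun v => m v - m (val x)))//; first exact: uniq_box.
by move=> y; exact: box_nbr.
Qed.

End linear.

(* With [P], [Q] the vacancy probabilities at the two ends of a bond, the gap
   between the two sides is [(P - Q)^2 / (P Q)] times the covariance of [f] with
   the indicator that both ends are occupied. *)
Lemma four_point (P Q f11 f10 f01 f00 : R) : 0 < P <= 1 -> 0 < Q <= 1 ->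
  f10 <= f11 -> f01 <= f11 -> f00 <= f11 ->
  (Q - P) * (f01 - f10) <=
  (Q^-1 - P^-1) * (P ^+ 2 * ((1 - Q) * (f11 - f01) + Q * (f10 - f00))) +
  (P^-1 - Q^-1) * (Q ^+ 2 * ((1 - P) * (f11 - f10) + P * (f01 - f00))).
Proof.
move=> /andP[P0 P1] /andP[Q0 Q1] h1 h2 h3; rewrite -subr_ge0.
have -> : (Q^-1 - P^-1) * (P ^+ 2 * ((1 - Q) * (f11 - f01) + Q * (f10 - f00))) +
    (P^-1 - Q^-1) * (Q ^+ 2 * ((1 - P) * (f11 - f10) + P * (f01 - f00))) -
    (Q - P) * (f01 - f10) =
  (P - Q) ^+ 2 / (P * Q) *
    (P * (1 - Q) * (f11 - f01) + Q * (1 - P) * (f11 - f10) + P * Q * (f11 - f00)).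
  by field; rewrite !gt_eqF.
by rewrite mulr_ge0 ?divr_ge0 ?sqr_ge0 ?mulr_ge0 ?addr_ge0 ?mulr_ge0 ?subr_ge0// ltW.
Qed.

Section product.
Variables (alpha : site d -> R) (alpha01 : forall x, 0 < alpha x < 1).

Let E := product_state alpha.

Let alpha01W x : 0 <= alpha x <= 1.
Proof. by have /andP[h1 h2] := alpha01 x; rewrite !ltW. Qed.

Let hE : local_state E := product_local_state alpha01W.

Let E_linear : local_linear E. Proof. exact: local_state_linear. Qed.

Let E_average x phi : is_local phi -> E (average alpha x phi) = E phi.
Proof. exact: product_state_average. Qed.

(** The discrete derivative at [x]. Under the product measure, Cov(phi, eta x) = alpha x (1 - alpha
    x) E (pivot x phi), which is the form in which covariances enter below. *)
Definition pivot x phi eta := phi (set_at x true eta) - phi (set_at x false eta).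

Lemma local_pivot x phi : is_local phi -> is_local (pivot x phi).
Proof. by move=> lphi; apply: localB; exact: local_set_at. Qed.

Lemma pivot_ge0 x phi : increasing phi -> forall eta, 0 <= pivot x phi eta.
Proof.
move=> iphi eta; rewrite subr_ge0; apply: iphi => y; rewrite /set_at.
by case: eqP => _ //; exact: implybb.
Qed.

Lemma state_pivot_ge0 x phi : is_local phi -> increasing phi -> 0 <= E (pivot x phi).
Proof.
by move=> lphi iphi; apply: (local_state_ge0 hE); [exact: local_pivot|exact: pivot_ge0].
Qed.

Lemma state_pivot_out s x phi : depends s phi -> x \notin s -> E (pivot x phi) = 0.
Proof.
move=> sphi xs; rewrite -[RHS](local_state0 hE); congr E; apply/funext => eta.
apply/eqP; rewrite subr_eq0; apply/eqP/sphi => y ys; rewrite /set_at.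
by case: eqP => // yx; rewrite -yx ys in xs.
Qed.

Section bond.
Variables (i j : site d) (ij : i != j) (phi : config d -> R) (lphi : is_local phi).

Let f u v eta := phi (set_at i u (set_at j v eta)).

Let lf u v : is_local (f u v).
Proof. by apply: (@local_set_at j v (fun z => phi (set_at i u z))); exact: local_set_at. Qed.

(** Only configurations with exactly one particle on the bond are changed; their probabilities alpha
    i (1 - alpha j) and (1 - alpha i) alpha j differ by alpha i - alpha j. *)
Lemma state_exchange :
  E (fun eta => phi (exchange i j eta) - phi eta) =
  E (fun eta => (alpha i - alpha j) * (f false true eta - f true false eta)).
Proof.
have lE : is_local (fun eta => phi (exchange i j eta) - phi eta).
  by apply: localB => //; exact: local_exchange.
rewrite -(E_average i lE) -(E_average j (local_average alpha i lE)).
have ex u v eta : exchange i j (set_at i u (set_at j v eta)) = set_at i v (set_at j u eta).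
  apply/funext => z; rewrite /exchange /set_at eqxx [j == i]eq_sym (negbTE ij) eqxx.
  by case: (eqVneq z i) => // _; case: (eqVneq z j).
congr E; apply/funext => eta; rewrite /average /f !ex; ring.
Qed.

Lemma state_pivot_left : E (pivot i phi) =
  E (fun eta => alpha j * (f true true eta - f false true eta) +
    (1 - alpha j) * (f true false eta - f false false eta)).
Proof. by rewrite -(@E_average j (pivot i phi) (local_pivot i lphi)). Qed.

Lemma state_pivot_right : E (pivot j phi) =
  E (fun eta => alpha i * (f true true eta - f true false eta) +
    (1 - alpha i) * (f false true eta - f false false eta)).
Proof.
rewrite -(@E_average i (pivot j phi) (local_pivot j lphi)).
congr product_state; apply/funext => eta; rewrite /average /pivot /f.
rewrite (set_atC true true eta ij) (set_atC true false eta ij).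
by rewrite (set_atC false true eta ij) (set_atC false false eta ij).
Qed.

(** After the two ends are integrated out, [four_point] applies pointwise in the remaining spins,
    with [P] and [Q] the vacancy probabilities. *)
Lemma state_exchange_le : increasing phi ->
  E (fun eta => phi (exchange i j eta) - phi eta) <=
  ((1 - alpha j)^-1 - (1 - alpha i)^-1) * ((1 - alpha i) ^+ 2 * E (pivot i phi)) +
  ((1 - alpha i)^-1 - (1 - alpha j)^-1) * ((1 - alpha j) ^+ 2 * E (pivot j phi)).
Proof.
move=> iphi; rewrite state_exchange state_pivot_left state_pivot_right.
have ld u v u' v' : is_local (fun eta => f u v eta - f u' v' eta) by exact: localB.
have lc c c' u v u' v' w z w' z' : is_local (fun eta =>
    c * (f u v eta - f u' v' eta) + c' * (f w z eta - f w' z' eta)).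
  by apply: localD; exact: localZ.
rewrite !mulrA -(local_linearZ E_linear)// -(local_linearZ E_linear)//.
rewrite -(local_linearD E_linear); [|exact: localZ|exact: localZ].
apply: (local_state_le hE); [exact: localZ|by apply: localD; exact: localZ|move=> eta].
have le u v u' v' : u ==> u' -> v ==> v' -> f u v eta <= f u' v' eta.
  move=> uu vv; apply: iphi => z; rewrite /set_at.
  by case: eqP => // _; case: eqP => // _; exact: implybb.
have := @four_point (1 - alpha i) (1 - alpha j) (f true true eta) (f true false eta)
  (f false true eta) (f false false eta).
have /andP[hi1 hi2] := alpha01 i; have /andP[hj1 hj2] := alpha01 j.
rewrite !subKr -!mulrA (_ : 1 - alpha j - (1 - alpha i) = alpha i - alpha j); last by ring.
apply; try exact: le.
  by rewrite subr_gt0 hi2 gerBl ltW.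
by rewrite subr_gt0 hj2 gerBl ltW.
Qed.

Lemma state_exchange_ge : increasing phi ->
  - E (fun eta => phi (exchange i j eta) - phi eta) <=
  ((alpha j)^-1 - (alpha i)^-1) * (alpha i ^+ 2 * E (pivot i phi)) +
  ((alpha i)^-1 - (alpha j)^-1) * (alpha j ^+ 2 * E (pivot j phi)).
Proof.
move=> iphi; rewrite state_exchange state_pivot_left state_pivot_right.
have ld u v u' v' : is_local (fun eta => f u v eta - f u' v' eta) by exact: localB.
have lc c c' u v u' v' w z w' z' : is_local (fun eta =>
    c * (f u v eta - f u' v' eta) + c' * (f w z eta - f w' z' eta)).
  by apply: localD; exact: localZ.
rewrite -mulN1r !mulrA -!(local_linearZ E_linear)//; last exact: localZ.
rewrite -(local_linearD E_linear); [|exact: localZ|exact: localZ].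
apply: (local_state_le hE); [by do 2!apply: localZ|by apply: localD; exact: localZ|move=> eta].
have le u v u' v' : u ==> u' -> v ==> v' -> f u v eta <= f u' v' eta.
  move=> uu vv; apply: iphi => z; rewrite /set_at.
  by case: eqP => // _; case: eqP => // _; exact: implybb.
(* Particle-hole symmetry: densities replace vacancy probabilities, and reversing the spins together
   with the sign keeps the function increasing. *)
have := @four_point (alpha i) (alpha j) (- f false false eta) (- f false true eta)
  (- f true false eta) (- f true true eta).
have /andP[hi1 hi2] := alpha01 i; have /andP[hj1 hj2] := alpha01 j.
have hi : 0 < alpha i <= 1 by rewrite hi1 ltW.
have hj : 0 < alpha j <= 1 by rewrite hj1 ltW.
rewrite !lerN2 => /(_ hi hj (le false false false true isT isT)).
move=> /(_ (le false false true false isT isT) (le false false true true isT isT)).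
rewrite -!mulrA mulN1r; congr (_ <= _); ring.
Qed.

End bond.

Lemma state_birth_death k phi : is_local phi ->
  E (fun eta => a * (phi (set_at k false eta) - phi eta) +
    b * (phi (set_at k true eta) - phi eta)) =
  (b * (1 - alpha k) - a * alpha k) * E (pivot k phi).
Proof.
move=> lphi; rewrite -(local_linearZ E_linear)//; last exact: local_pivot.
rewrite -(E_average k); last first.
  apply: localD; apply: localZ; apply: localB => //; exact: local_set_at.
by congr E; apply/funext => eta; rewrite /average /pivot !set_atK; ring.
Qed.

Variables (m : 'rV[int]_d -> R) (lambda : R) (lambda0 : 0 < lambda).
Hypothesis m_superharmonic : forall x,
  \sum_(v <- steps d | val x + v != 0) (m (val x + v) - m (val x)) <= 0.

Lemma gen_state_le0 :
  (forall x, (1 - alpha x)^-1 = 1 + lambda * m (val x)) ->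
  (forall k, nbr_origin k -> b * (1 - alpha k) <= a * alpha k) ->
  forall phi, is_local phi -> increasing phi -> E (gen a b phi) <= 0.
Proof.
move=> alphaE bd phi lphi iphi; have [n sphi] := local_box lphi.
(* Since alpha x = lambda m x (1 - alpha x), this [g x] equals Cov(phi, eta x) / m x. *)
apply: (gen_le0 E_linear (m := m)
  (g := fun x => lambda * ((1 - alpha x) ^+ 2 * E (pivot x phi))) sphi) => //.
- move=> x; apply: mulr_ge0; first exact: ltW.
  by apply: mulr_ge0; [exact: sqr_ge0|exact: state_pivot_ge0].
- by move=> x /(state_pivot_out sphi) ->; rewrite !mulr0.
- move=> x y bxy; apply: le_trans (state_exchange_le (bond_neq bxy) lphi iphi) _.
  by rewrite !alphaE le_eqVlt; apply/orP; left; apply/eqP; ring.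
move=> k kn; rewrite state_birth_death// mulr_le0_ge0 ?state_pivot_ge0//.
by rewrite subr_le0 bd.
Qed.

Lemma gen_state_ge0 :
  (forall x, (alpha x)^-1 = 1 + lambda * m (val x)) ->
  (forall k, nbr_origin k -> a * alpha k <= b * (1 - alpha k)) ->
  forall phi, is_local phi -> increasing phi -> - E (gen a b phi) <= 0.
Proof.
move=> alphaE bd phi lphi iphi; have [n sphi] := local_box lphi.
have NE_linear : local_linear (fun phi => - E phi).
  by move=> c phi1 phi2 l1 l2; rewrite E_linear//; ring.
(* Here 1 - alpha x = lambda m x alpha x, so [g x] is again Cov(phi, eta x) / m x; working with - E
   turns the lower bound into the same inequality. *)
apply: (gen_le0 NE_linear (m := m)
  (g := fun x => lambda * (alpha x ^+ 2 * E (pivot x phi))) sphi) => //.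
- move=> x; apply: mulr_ge0; first exact: ltW.
  by apply: mulr_ge0; [exact: sqr_ge0|exact: state_pivot_ge0].
- by move=> x /(state_pivot_out sphi) ->; rewrite !mulr0.
- move=> x y bxy; apply: le_trans (state_exchange_ge (bond_neq bxy) lphi iphi) _.
  by rewrite !alphaE le_eqVlt; apply/orP; left; apply/eqP; ring.
move=> k kn; rewrite state_birth_death// oppr_le0 mulr_ge0 ?state_pivot_ge0//.
by rewrite subr_ge0 bd.
Qed.

End product.

End generator_sign.

(** * The stationary limit *)

Section mean.
Context {R : realType} {d : nat} (mu : probability (config d) R).
Implicit Types (eta : config d) (f g : config d -> R) (c e : R).

Definition mean f : R := fine (\int[mu]_eta (f eta)%:E)%E.

Lemma meanE f : continuous f -> (\int[mu]_eta (f eta)%:E = (mean f)%:E)%E.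
Proof.
by move=> cf; rewrite fineK//; apply: integrable_fin_num => //; exact: continuous_integrable.
Qed.

Lemma mean_linear c f g : continuous f -> continuous g ->
  mean (fun eta => c * f eta + g eta) = c * mean f + mean g.
Proof.
move=> cf cg; apply: EFin_inj; rewrite -meanE; last exact: continuous_lin.
have if_ := continuous_integrable mu cf; have ig := continuous_integrable mu cg.
under eq_integral do rewrite EFinD EFinM.
rewrite integralD//; last exact: integrableZl.
by rewrite integralZl// (meanE cf) (meanE cg).
Qed.

Lemma mean_cst c : mean (fun=> c) = c.
Proof. by rewrite /mean integral_cst// [X in (_ * X)%E]probability_setT mule1. Qed.

Lemma mean_le f g : continuous f -> continuous g ->
  (forall eta, f eta <= g eta) -> mean f <= mean g.
Proof.
move=> cf cg fg; rewrite -lee_fin -!meanE//; apply: le_integral => //.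
- exact: continuous_integrable.
- exact: continuous_integrable.
- by move=> eta _; rewrite lee_fin.
Qed.

Lemma mean_close f g e : continuous f -> continuous g ->
  (forall eta, `|f eta - g eta| <= e) -> `|mean f - mean g| <= e.
Proof.
move=> cf cg fg; have ce := @continuous_fcst R d e.
have shift (h : config d -> R) : continuous h -> mean (fun eta => 1 * h eta + e) = mean h + e.
  by move=> ch; rewrite mean_linear// mean_cst mul1r.
rewrite ler_distl lerBlDr -!shift//; apply/andP; split.
  apply: mean_le => //; first exact: continuous_lin.
  by move=> eta; have := fg eta; rewrite mul1r ler_distl lerBlDr => /andP[].
apply: mean_le => //; first exact: continuous_lin.
by move=> eta; have := fg eta; rewrite mul1r ler_distl => /andP[].
Qed.

End mean.

(** * Comparison of product measures *)

Section comparison.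
Context {R : realType} {d : nat}.
Implicit Types (x : site d) (phi psi : config d -> R) (alpha beta : site d -> R).

Lemma average_increasing alpha x phi : (forall x, 0 <= alpha x <= 1) ->
  increasing phi -> increasing (average alpha x phi).
Proof.
move=> alpha01 iphi eta zeta ez; have /andP[h1 h2] := alpha01 x.
by rewrite lerD// ler_wpM2l ?subr_ge0//; apply: iphi => y; rewrite /set_at;
  case: eqP => _; do ?exact: ez; exact: implybb.
Qed.

(** Densities are raised one site at a time; each change adds [beta x - alpha x] times a pivot,
    nonnegative because averaging preserves increasing functions. *)
Lemma averages_mono alpha beta s phi : (forall x, 0 <= alpha x <= 1) ->
  (forall x, 0 <= beta x <= 1) -> (forall x, alpha x <= beta x) -> increasing phi ->
  increasing (averages beta s phi) /\
  forall eta, averages alpha s phi eta <= averages beta s phi eta.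
Proof.
move=> alpha01 beta01 ab iphi; elim: s => //= x s [ibeta le].
split=> [|eta]; first exact: average_increasing.
have /andP[h1 h2] := alpha01 x.
apply: (@le_trans _ _ (average alpha x (averages beta s phi) eta)).
  by rewrite lerD// ler_wpM2l ?subr_ge0.
have p0 : 0 <= pivot x (averages beta s phi) eta by exact: pivot_ge0.
rewrite -subr_ge0 (_ : _ - _ = (beta x - alpha x) * pivot x (averages beta s phi) eta).
  by rewrite mulr_ge0// subr_ge0.
by rewrite /average /pivot; ring.
Qed.

Lemma product_state_mono alpha beta phi : (forall x, 0 <= alpha x <= 1) ->
  (forall x, 0 <= beta x <= 1) -> (forall x, alpha x <= beta x) ->
  is_local phi -> increasing phi -> product_state alpha phi <= product_state beta phi.
Proof.
move=> alpha01 beta01 ab lphi iphi.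
have [N1 E1] := product_state_eventually alpha lphi.
have [N2 E2] := product_state_eventually beta lphi.
have [_ /(_ point)] := averages_mono (exhaust (N1 + N2)) alpha01 beta01 ab iphi.
by rewrite E1 ?leq_addr// E2 ?leq_addl.
Qed.

Lemma contractive_state (E : (config d -> R) -> R) : local_state E -> contractive E.
Proof.
move=> hE; split=> [|phi M lphi phiM]; first exact: local_state_linear.
rewrite -(local_state_cst hE M); apply: (local_state_le hE) => //; first exact: local_cst.
by move=> eta; apply: le_trans (ler_norm _) _.
Qed.

Lemma contractive_stateN (E : (config d -> R) -> R) :
  local_state E -> contractive (fun phi => - E phi).
Proof.
move=> hE; split=> [c phi psi lphi lpsi|phi M lphi phiM].
  by rewrite (local_state_linear hE)//; ring.
rewrite lerNl -(local_state_cst hE (- M)).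
apply: (local_state_le hE) => //; first exact: local_cst.
by move=> eta; rewrite lerNl; apply: le_trans (phiM eta); rewrite -normrN ler_norm.
Qed.

End comparison.

Section stationary_limit.
Context {R : realType} {d : nat} (a b : R) (a0 : 0 <= a) (b0 : 0 <= b).
Variables (S : R -> (config d -> R) -> config d -> R).
Hypotheses (hS : markov_semigroup S) (hSL : generated_by S (gen a b)).
Variables (E E' : (config d -> R) -> R) (hE : local_state E) (hE' : local_state E').
Hypothesis E_sub : gen_decreasing a b (fun phi => - E phi).
Hypothesis E'_super : gen_decreasing a b E'.
Hypothesis EE' : forall phi, is_local phi -> increasing phi -> E phi <= E' phi.
Variable nu : probability (config d) R.
Hypothesis nuE : forall phi : config d -> R, is_local phi -> 
  (\int[nu]_eta (phi eta)%:E = (E phi)%:E)%E.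
Implicit Types (eta : config d) (f g phi psi : config d -> R) (s t e : R).

Let J := mean nu.

Let J_local phi : is_local phi -> J phi = E phi.
Proof. by move=> lphi; rewrite /J /mean nuE. Qed.

Let contS t f : 0 <= t -> continuous f -> continuous (S t f).
Proof. exact: semigroup_continuous. Qed.

Let approx g t e : is_local g -> 0 <= t -> 0 < e ->
  exists phi, [/\ is_local phi, forall eta, `|S t g eta - phi eta| <= e,
    increasing g -> increasing phi &
    increasing g -> E g <= E phi + e /\ E' phi <= E' g + e].
Proof.
move=> lg t0 e0; have [phi [lphi gphi ig le]] := semigroup_approx a0 b0 hS hSL lg t0 e0.
exists phi; split=> // ig'; split; last exact: le (contractive_state hE') E'_super ig'.
by have := le _ (contractive_stateN hE) E_sub ig'; lra.
Qed.

Let J_step g t : is_local g -> increasing g -> 0 <= t -> J g <= J (S t g).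
Proof.
move=> lg ig t0; apply/ler_addgt0Pr => e e0; have e2 : 0 < e / 2 by rewrite divr_gt0.
have [phi [lphi gphi _ /(_ ig)[le _]]] := approx lg t0 e2.
have cg := local_continuous lg; have cphi := local_continuous lphi.
have := mean_close nu (contS t0 cg) cphi gphi.
rewrite -/J (J_local lphi) (J_local lg) ler_distl => /andP[]; lra.
Qed.

(** [S s g] need not be local, so [J_step] is applied to a local increasing approximant of it and
    the error is carried along by contraction. *)
Let J_mono g s t : is_local g -> increasing g -> 0 <= s -> s <= t -> J (S s g) <= J (S t g).
Proof.
move=> lg ig s0 st; have r0 : 0 <= t - s by rewrite subr_ge0.
have cg := local_continuous lg.
apply/ler_addgt0Pr => e e0; have e2 : 0 < e / 2 by rewrite divr_gt0.
have [phi [lphi gphi /(_ ig) iphi _]] := approx lg s0 e2.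
have cphi := local_continuous lphi.
have -> : S t g = S (t - s) (S s g) by rewrite -(semigroup_add hS r0 s0 cg) subrK.
have h1 := mean_close nu (contS s0 cg) cphi gphi.
have h2 := mean_close nu (contS r0 (contS s0 cg)) (contS r0 cphi)
  (semigroup_contraction hS r0 (contS s0 cg) cphi gphi).
have h3 := J_step lphi iphi r0.
move: h1 h2; rewrite -/J !ler_distl => /andP[_ h1] /andP[h2 _]; lra.
Qed.

Let J_upper g t : is_local g -> increasing g -> 0 <= t -> J (S t g) <= E' g.
Proof.
move=> lg ig t0; apply/ler_addgt0Pr => e e0; have e2 : 0 < e / 2 by rewrite divr_gt0.
have [phi [lphi gphi /(_ ig) iphi /(_ ig)[_ le]]] := approx lg t0 e2.
have cg := local_continuous lg; have cphi := local_continuous lphi.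
have := mean_close nu (contS t0 cg) cphi gphi; have := EE' lphi iphi.
rewrite -/J (J_local lphi) ler_distl => h /andP[_]; lra.
Qed.

Let u g (n : nat) : R := J (S n%:R g).

(** Integer times suffice: for increasing [g], [J_mono] places the value at a real time between
    those at neighbouring integers. *)
Definition limit_state g : R := limn (u g).

Let nat_ge0 (n : nat) : 0 <= n%:R :> R. Proof. exact: ler0n. Qed.

Let u_linear c phi psi n : is_local phi -> is_local psi ->
  u (fun eta => c * phi eta + psi eta) n = c * u phi n + u psi n.
Proof.
move=> /local_continuous cphi /local_continuous cpsi.
rewrite /u (semigroup_linear hS)//; apply: mean_linear; exact: contS.
Qed.

Let u_incr_cvg g : is_local g -> increasing g -> cvgn (u g).
Proof.
move=> lg ig; apply: nondecreasing_is_cvgn.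
  by move=> m n mn; apply: J_mono => //; rewrite ler_nat.
by exists (E' g) => _ [n _ <-]; exact: J_upper.
Qed.

(** Convergence is linear in the function, and the increasing monomials [all_occupied] span the
    local functions. *)
Let u_cvg phi : is_local phi -> cvgn (u phi).
Proof.
move: phi; apply: local_ind => [c phi psi lphi lpsi cphi cpsi|t].
  rewrite (_ : u _ = fun n => c * u phi n + u psi n).
    by apply: is_cvgD => //; apply: is_cvgM => //; exact: is_cvg_cst.
  by apply/funext => n; exact: u_linear.
apply: u_incr_cvg; last exact: increasing_all_occupied.
exact/depends_local/depends_all_occupied.
Qed.

Lemma local_state_limit : local_state limit_state.
Proof.
split=> [c phi psi lphi lpsi|phi lphi phi0|].
- apply/cvg_lim => //; rewrite (_ : u _ = fun n => c * u phi n + u psi n).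
    apply: cvgD; last exact: u_cvg.
    by apply: cvgM; [exact: cvg_cst|exact: u_cvg].
  by apply/funext => n; exact: u_linear.
- apply: limr_ge; first exact: u_cvg.
  apply: nearW => n; rewrite -(mean_cst nu 0); apply: mean_le.
  + exact: continuous_fcst.
  + by apply: contS => //; exact: local_continuous.
  + by apply: (semigroup_pos hS) => //; exact: local_continuous.
apply/cvg_lim => //; rewrite (_ : u _ = fun=> 1); first exact: cvg_cst.
by apply/funext => n; rewrite /u (semigroup_one hS)// /J mean_cst.
Qed.

Lemma limit_state_bounds g : is_local g -> increasing g -> E g <= limit_state g <= E' g.
Proof.
move=> lg ig; apply/andP; split.
  apply: limr_ge; first exact: u_cvg.
  by apply: nearW => n; rewrite -J_local//; exact: J_step.
apply: limr_le; first exact: u_cvg.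
by apply: nearW => n; exact: J_upper.
Qed.

Variable mu : probability (config d) R.
Hypothesis muE : forall phi : config d -> R, is_local phi -> 
  (\int[mu]_eta (phi eta)%:E = (limit_state phi)%:E)%E.

Let mu_local phi : is_local phi -> mean mu phi = limit_state phi.
Proof. by move=> lphi; rewrite /mean muE. Qed.

(** A local [phi] close to [S t g] has [u phi n] close to [J (S (n%:R + t) g)], which tends to
    [limit_state g] by monotonicity in time. Hence the limits for [phi] and [g] are close. *)
Let mean_stationary_incr g t : is_local g -> increasing g -> 0 <= t ->
  mean mu (S t g) = mean mu g.
Proof.
move=> lg ig t0; apply/eqP; rewrite eq_sym -subr_eq0 -normr_le0.
apply/ler_addgt0Pr => e e0; rewrite add0r; have e3 : 0 < e / 3 by rewrite divr_gt0.
have cg := local_continuous lg.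
have [phi [lphi gphi _ _]] := approx lg t0 e3.
have cphi := local_continuous lphi.
have h1 := mean_close mu (contS t0 cg) cphi gphi.
have ub n : u g n <= limit_state g.
  apply: nondecreasing_cvgn_le; last exact: u_incr_cvg.
  by move=> p q pq; apply: J_mono => //; rewrite ler_nat.
have ubt s : 0 <= s -> J (S s g) <= limit_state g.
  move=> s0; apply: le_trans (ub (Num.bound s)); apply: J_mono => //.
  exact/ltW/archi_boundP.
have near_phi n : `|J (S (n%:R + t) g) - u phi n| <= e / 3.
  rewrite /u (semigroup_add hS (nat_ge0 n) t0 cg).
  apply: mean_close; [exact/contS/contS|exact: contS|].
  exact: semigroup_contraction (contS t0 cg) cphi gphi.
have up : limit_state phi <= limit_state g + e / 3.
  apply: limr_le; first exact: u_cvg.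
  apply: nearW => n; have := ubt _ (addr_ge0 (nat_ge0 n) t0); have := near_phi n.
  by rewrite ler_distl => /andP[]; lra.
have lo : limit_state g <= limit_state phi + e / 3.
  apply: limr_le; first exact: u_cvg.
  apply: nearW => n; rewrite -lerBlDr; apply: limr_ge; first exact: u_cvg.
  exists n => // p /= np; have := near_phi p; rewrite ler_distl => /andP[_].
  have : u g n <= J (S (p%:R + t) g).
    by apply: J_mono => //; apply: (@le_trans _ _ p%:R); rewrite ?ler_nat ?lerDl.
  by lra.
move: h1; rewrite (mu_local lphi) (mu_local lg) !ler_norml; lra.
Qed.

Lemma mean_stationary f t : continuous f -> 0 <= t -> mean mu (S t f) = mean mu f.
Proof.
move=> cf t0.
have loc : forall phi, is_local phi -> mean mu (S t phi) = mean mu phi.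
  apply: local_ind => [c phi psi lphi lpsi Ephi Epsi|s].
    have cphi := local_continuous lphi; have cpsi := local_continuous lpsi.
    rewrite (semigroup_linear hS)// !mean_linear// ?Ephi ?Epsi//; exact: contS.
  apply: mean_stationary_incr => //; last exact: increasing_all_occupied.
  exact/depends_local/depends_all_occupied.
apply/eqP; rewrite eq_sym -subr_eq0 -normr_le0.
apply/ler_addgt0Pr => e e0; rewrite add0r; have e2 : 0 < e / 2 by rewrite divr_gt0.
have [phi [lphi fphi _]] := local_approx cf e2.
have cphi := local_continuous lphi.
have h1 := mean_close mu cf cphi fphi.
have := mean_close mu (contS t0 cf) (contS t0 cphi) (semigroup_contraction hS t0 cf cphi fphi).
rewrite (loc _ lphi) => h2.
rewrite (_ : _ - _ = (mean mu f - mean mu phi) - (mean mu (S t f) - mean mu phi)); last by lra.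
by apply: le_trans (ler_normB _ _) _; lra.
Qed.

End stationary_limit.

(** At a neighbour of the origin the restricted sum omits the term leading to the origin, where [h]
    has its maximal value 1; the omitted increment is nonnegative. *)
Lemma superharmonic_off_origin (R : realType) d (h : 'rV[int]_d -> R) (C : R) (x : site d) :
  h 0 = 1 -> h (val x) <= 1 -> 0 <= C ->
  \sum_(v <- steps d) (h (val x + v) - h (val x)) = 0 ->
  \sum_(v <- steps d | val x + v != 0)
    (1 + C * h (val x + v) - (1 + C * h (val x))) <= 0.
Proof.
move=> h0 hx C0 harm.
have -> : \sum_(v <- steps d | val x + v != 0)
    (1 + C * h (val x + v) - (1 + C * h (val x))) =
    C * \sum_(v <- steps d | val x + v != 0) (h (val x + v) - h (val x)).
  by rewrite mulr_sumr; apply: eq_bigr => v _; ring.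
move: harm; rewrite (bigID (fun v => val x + v != 0)) /= => harm.
rewrite mulr_ge0_le0//.
have : 0 <= \sum_(v <- steps d | ~~ (val x + v != 0)) (h (val x + v) - h (val x)).
  by apply: sumr_ge0 => v /negPn/eqP ->; rewrite h0 subr_ge0.
lra.
Qed.

Theorem proposition1p6 (R : realType) (d : nat) (hd : (5 <= d)%N)
    (a b : R) (ha : 0 < a) (hb : 0 < b)
    (S : R -> (config d -> R) -> config d -> R)
    (hS : markov_semigroup S) (hSL : generated_by S (gen a b))
    (dW : measure_display) (W : measurableType dW) (P : probability W R)
    (xi : nat -> W -> 'rV[int]_d) (hxi : srw_steps P xi)
    (rho : R) (hrho : 0 < rho < 1) :
  exists C : R, 0 < C /\
  exists (alpha alpha' : site d -> R) (nu nu' mu : probability (config d) R),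
    [/\ forall i : site d,
          1 + C * hitting_prob P xi (val i)
            = alpha' i / rho * ((1 - rho) / (1 - alpha' i)) /\
          alpha' i / rho * ((1 - rho) / (1 - alpha' i))
            = rho / alpha i * ((1 - alpha i) / (1 - rho)),
        product_bernoulli alpha nu /\ product_bernoulli alpha' nu',
        stationary S mu,
        dominated nu mu &
        dominated mu nu'].
Proof.
have d0 : (0 < d)%N by exact: leq_trans hd.
have /andP[rho0 rho1] := hrho.
have rho1' : 0 < 1 - rho by rewrite subr_gt0.
pose lam := rho / (1 - rho).
have lam0 : 0 < lam by rewrite divr_gt0.
pose h := hitting_prob P xi.
have h_ge0 x : 0 <= h x by exact: hitting_prob_ge0.
have h_le1 x : h x <= 1 by exact: hitting_prob_le1.
(* Next to the origin the upper bound needs m >= b / (a lam) and the lower one m >= a lam / b; the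
   sum dominates both. The factor [2 * d] in [C] compensates the bound 1 / (2 d) on the hitting
   probability there. *)
pose C0 := b / (a * lam) + a * lam / b.
have al0 : 0 < a * lam by rewrite mulr_gt0.
have C00 : 0 < C0 by rewrite addr_gt0// divr_gt0.
pose C := (2 * d)%:R * C0.
have C_gt0 : 0 < C by rewrite mulr_gt0// ltr0n muln_gt0.
pose m x := 1 + C * h x.
have m1 x : 1 <= m x by rewrite /m lerDl mulr_ge0// ltW.
have m0 x : 0 < m x by exact: lt_le_trans (m1 x).
have m_nbr k : k \in steps d -> C0 <= m k.
  move=> ks; have := hitting_prob_nbr d0 hxi ks => /(ler_wpM2l (ltW C_gt0)).
  rewrite /m -/h mulrAC divff ?mul1r ?pnatr_eq0 -?lt0n ?muln_gt0// => le.
  by apply: le_trans le _; rewrite lerDr.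
have m_super (x : site d) :
    \sum_(v <- steps d | val x + v != 0) (m (val x + v) - m (val x)) <= 0.
  apply: superharmonic_off_origin => //; first exact: hitting_prob0.
    exact: ltW.
  exact: hitting_prob_harmonic (valP x).
(* Odds lam / m and lam m, written so that the inverse of the density, respectively of the vacancy
   probability, is affine in [m], as the sign lemmas require. *)
pose alpha (x : site d) := (1 + lam^-1 * m (val x))^-1.
pose alpha' (x : site d) := 1 - (1 + lam * m (val x))^-1.
have lm0 x : 0 < lam * m x by rewrite mulr_gt0.
have lm0' x : 0 < lam^-1 * m x by rewrite mulr_gt0// invr_gt0.
have alphaE x : (alpha x)^-1 = 1 + lam^-1 * m (val x) by rewrite invrK.
have alphaE' x : (1 - alpha' x)^-1 = 1 + lam * m (val x) by rewrite subKr invrK.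
have inv01 (t : R) : 0 < t -> 0 < (1 + t)^-1 < 1.
  by move=> t0; rewrite invr_gt0 invf_lt1 ?ltrDl// !addr_gt0.
have alpha01 x : 0 < alpha x < 1 by exact: inv01.
have alpha01' x : 0 < alpha' x < 1.
  by have /andP[i0 i1] := inv01 _ (lm0 (val x)); rewrite subr_gt0 i1 gtrBl.
have alpha01W x : 0 <= alpha x <= 1 by have /andP[? ?] := alpha01 x; rewrite !ltW.
have alpha01W' x : 0 <= alpha' x <= 1 by have /andP[? ?] := alpha01' x; rewrite !ltW.
have le_alpha x : alpha x <= alpha' x.
  have mx := m0 (val x).
  (* The order of the densities reduces to m >= 1. *)
  have E : alpha' x - alpha x = ((m (val x)) ^+ 2 - 1) /
      ((1 + lam * m (val x)) * (1 + lam^-1 * m (val x))).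
    rewrite /alpha' /alpha; field.
    rewrite (gt_eqF lam0) (gt_eqF (addr_gt0 lam0 mx)).
    by rewrite (gt_eqF (addr_gt0 ltr01 (lm0 (val x)))).
  rewrite -subr_ge0 E; apply: divr_ge0; first by rewrite subr_ge0 exprn_ege1.
  by apply/ltW/mulr_gt0; exact: addr_gt0.
have [nu [rnu bnu nuE]] := exists_product alpha01W.
have [nu' [_ bnu' nuE']] := exists_product alpha01W'.
have sub : gen_decreasing a b (fun phi => - product_state alpha phi).
  (* The parameter [lambda] is [lam^-1] here, in accordance with particle-hole symmetry. *)
  move=> phi; apply: (gen_state_ge0 alpha01 _ m_super alphaE); first by rewrite invr_gt0.
  move=> k /m_nbr km; rewrite -subr_ge0.
  have -> : b * (1 - alpha k) - a * alpha k = alpha k * (b * ((alpha k)^-1 - 1) - a).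
    by field; rewrite gt_eqF//; have /andP[] := alpha01 k.
  have /andP[ak _] := alpha01 k.
  rewrite mulr_ge0 ?(ltW ak)// alphaE addrAC subrr add0r subr_ge0.
  have : a * lam / b <= m (val k) by apply: le_trans km; rewrite lerDr divr_ge0// ltW.
  rewrite ler_pdivrMr// => le.
  by rewrite (_ : b * _ = m (val k) * b / lam) ?ler_pdivlMr//; ring.
have super : gen_decreasing a b (product_state alpha').
  move=> phi; apply: (gen_state_le0 alpha01' lam0 m_super alphaE').
  move=> k /m_nbr km; rewrite -subr_ge0.
  have /andP[_ ak] := alpha01' k; have ak' : 0 < 1 - alpha' k by rewrite subr_gt0.
  have -> : a * alpha' k - b * (1 - alpha' k) =
      (1 - alpha' k) * (a * ((1 - alpha' k)^-1 - 1) - b).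
    by field; rewrite gt_eqF.
  rewrite mulr_ge0 ?(ltW ak')// alphaE' addrAC subrr add0r subr_ge0.
  have : b / (a * lam) <= m (val k) by apply: le_trans km; rewrite lerDl divr_ge0// ltW.
  by rewrite ler_pdivrMr// mulrC -mulrA.
have comparison phi : is_local phi -> increasing phi ->
    product_state alpha phi <= product_state alpha' phi by exact: product_state_mono.
have hE := product_local_state alpha01W; have hE' := product_local_state alpha01W'.
have hL := local_state_limit (ltW ha) (ltW hb) hS hSL hE hE' sub super comparison nuE.
have [mu [rmu muE]] := state_probability hL.
have bounds := limit_state_bounds (ltW ha) (ltW hb) hS hSL hE hE' sub super comparison nuE.
exists C; split=> //; exists alpha, alpha', nu, nu', mu; split=> //.
- move=> i; have mi := m0 (val i); have li := lm0 (val i).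
  have -> : 1 + C * hitting_prob P xi (val i) = lam * m (val i) / lam.
    by rewrite [RHS]mulrAC divff ?gt_eqF// mul1r.
  have -> : alpha' i / rho * ((1 - rho) / (1 - alpha' i)) =
      ((1 - alpha' i)^-1 - 1) / lam.
    have /andP[_ ai] := alpha01' i; rewrite -subr_gt0 in ai.
    by rewrite /lam; field; rewrite (gt_eqF rho0) (gt_eqF rho1') (gt_eqF ai).
  have -> : rho / alpha i * ((1 - alpha i) / (1 - rho)) = lam * ((alpha i)^-1 - 1).
    have /andP[ai _] := alpha01 i.
    by rewrite /lam; field; rewrite (gt_eqF ai) (gt_eqF rho1').
  rewrite alphaE alphaE' addrAC subrr add0r; split=> //.
  rewrite addrAC subrr add0r.
  by field; rewrite (gt_eqF lam0).
- move=> t f t0 cf.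
  have cS := semigroup_continuous hS t0 cf.
  rewrite (meanE mu cf) (meanE mu cS).
  by rewrite (mean_stationary (ltW ha) (ltW hb) hS hSL hE hE' sub super comparison nuE muE).
- apply: dominated_local => // phi lphi iphi.
  by rewrite nuE// muE// lee_fin; have /andP[] := bounds _ lphi iphi.
- apply: dominated_local => // phi lphi iphi.
  by rewrite nuE'// muE// lee_fin; have /andP[] := bounds _ lphi iphi.
Qed.
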